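(* Let $M=(M^{2m+1};\varphi,\xi,\eta,g)$ be an almost semi-Sasakian manifold and let $f:M\to N$ be a $(\pm)$-holomorphic map into an almost contact metric manifold $N=(N^{2n+1};\phi,\gamma,\sigma,h)$. (1) If $N$ is quasi-$\mathcal K$-cosymplectic, then $f$ is harmonic. (2) If $N$ is $\alpha$-Sasakian, then $f$ is harmonic if and only if $d\lambda(\xi)=0$.
   Context: Manifolds and maps are smooth; $\nabla$ denotes Levi-Civita connections. An almost contact metric manifold $M=(M^{2m+1};\varphi,\xi,\eta,g)$ is a $(2m+1)$-dimensional Riemannian manifold with a $(1,1)$-tensor $\varphi$, a vector field $\xi$ and a 1-form $\eta$ such that $\varphi^2X=-X+\eta(X)\xi$, $\eta(\xi)=1$, $g(\varphi X,\varphi Y)=g(X,Y)-\eta(X)\eta(Y)$. Put $\Omega(X,Y)=g(X,\varphi Y)$, $P(X,Y)=(\nabla_X\varphi)Y+(\nabla_{\varphi X}\varphi)\varphi Y$, and $\delta\Omega(X)=g(-\varphi(\nabla_\xi\xi)+\sum_{i=1}^mP(e_i,e_i),X)$ for any local orthonormal frame $\{e_i;\varphi e_i;\xi\}_{1\le i\le m}$. $M$ is almost semi-Sasakian if $\delta\Omega=2m\eta$; quasi-$\mathcal K$-cosymplectic if $P(X,Y)=\eta(Y)\nabla_{\varphi X}\xi$ for all $X,Y$; $\alpha$-Sasakian ($\alpha$ a nonzero real constant) if $(\nabla_X\varphi)Y=\alpha\{g(X,Y)\xi-\eta(Y)X\}$ for all $X,Y$. The same notions apply to $N$ with $(\phi,\gamma,\sigma,h,n)$.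 $f$ is $(\pm)$-holomorphic if $f_*\varphi=\phi f_*$ or $f_*\varphi=-\phi f_*$; then $f_*\xi=\lambda\gamma$ for a function $\lambda\in C^\infty(M)$, which defines $\lambda$. $f$ is harmonic if its tension field vanishes.
   Formalization: Part (1) is stated for m ≥ 1; for m = 0 it fails, e.g. M = N = R with zero structure tensors φ and ϕ, and f(t) = t², which is (±)-holomorphic but not harmonic. *)

(* Defs.v *)
From HB Require Import structures.
From mathcomp Require Import all_boot all_order all_algebra.
From mathcomp Require Import all_classical all_reals all_analysis.
From mathcomp Require Import ring.

Set Implicit Arguments.
Unset Strict Implicit.
Unset Printing Implicit Defensive.

Import Order.TTheory GRing.Theory Num.Theory.
Import numFieldNormedType.Exports.

Local Open Scope classical_set_scope.
Local Open Scope ring_scope.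

(* Tensor fields on a manifold are given by their components in the charts of
   an atlas, subject to the usual transformation laws.  Tangent vectors are row
   vectors and matrices act on the right: an endomorphism F sends X to X *m F,
   a 1-form w (a column) sends X to (X *m w) 0 0. *)

Section Smooth.
Context {R : realType}.

(* Meant for U open; 'd f x is the Frechet differential. *)
Fixpoint Ck (k : nat) (V W : normedModType R) (U : set V) (f : V -> W) : Prop :=
  match k with
  | 0%N => forall x, U x -> {for x, continuous f}
  | k'.+1 => (forall x, U x -> differentiable f x) /\
             (forall v, Ck k' U (fun x => 'd f x v))
  end.

Definition smooth_on (V W : normedModType R) (U : set V) (f : V -> W) : Prop :=
  forall k, Ck k U f.

End Smooth.

Record manifold (R : realType) (d : nat) := Manifold {
  carrier :> topologicalType;
  atlas : Type;
  chart_dom : atlas -> set carrier;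
  chart : atlas -> carrier -> 'rV[R]_d;
  param : atlas -> 'rV[R]_d -> carrier;
  manifold_hausdorff : hausdorff_space carrier;
  manifold_second_countable : @second_countable carrier;
  chart_dom_cover : forall p, exists i, chart_dom i p;
  chart_dom_open : forall i, open (chart_dom i);
  chart_open : forall i, open (chart i @` chart_dom i);
  chartK : forall i p, chart_dom i p -> param i (chart i p) = p;
  chart_continuous : forall i p, chart_dom i p -> {for p, continuous (chart i)};
  param_continuous : forall i u, (chart i @` chart_dom i) u ->
    {for u, continuous (param i)};
  transition_smooth : forall i j,
    smooth_on (chart i @` (chart_dom i `&` chart_dom j)) (chart j \o param i)
}.

Section LocalGeometry.
Context {R : realType} {d : nat}.
Local Notation E := 'rV[R]_d.

Definition pairing (w : 'cV[R]_d) (X : E) : R := (X *m w) 0 0.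

Definition inner (G : 'M[R]_d) (X Y : E) : R := (X *m G *m Y^T) 0 0.

Definition posdef (G : 'M[R]_d) : Prop :=
  G^T = G /\ forall X, X != 0 -> 0 < inner G X X.

Definition basis_vec (a : 'I_d) : E := delta_mx 0 a.

(* The Christoffel symbols of the metric g at u, as a bilinear map
   (X, Y) |-> X^a Y^b Gamma_ab.  The lemmas christoffelC, christoffel_metric
   and christoffel_unique below identify it as the only torsion-free
   connection that is compatible with g. *)
Definition christoffel (g : E -> 'M[R]_d) (u X Y : E) : E :=
  2^-1 *: (\row_c (inner ('d g u X) Y (basis_vec c)
                   + inner ('d g u Y) X (basis_vec c)
                   - inner ('d g u (basis_vec c)) X Y)) *m invmx (g u).

(* nabla_X V at u, for a vector field V *)
Definition covd (g : E -> 'M[R]_d) (V : E -> E) (u X : E) : E :=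
  'd V u X + christoffel g u X (V u).

(* (nabla_X F) Y = nabla_X (F Y) - F (nabla_X Y), the vector Y being extended
   to the field with constant components. *)
Definition covd_end (g : E -> 'M[R]_d) (F : E -> 'M[R]_d) (u X Y : E) : E :=
  covd g (fun v => Y *m F v) u X - covd g (cst Y) u X *m F u.

End LocalGeometry.

(* (nabla df)(X, Y) = nabla_X (df Y) - df (nabla_X Y) for a map F between open
   sets of R^d and R^e with metrics g and h, the vector Y being extended to the
   field with constant components. *)
Definition second_fundamental_form (R : realType) (d e : nat)
    (g : 'rV[R]_d -> 'M[R]_d) (h : 'rV[R]_e -> 'M[R]_e)
    (F : 'rV[R]_d -> 'rV[R]_e) (u X Y : 'rV[R]_d) : 'rV[R]_e :=
  'd (fun v => 'd F v Y) u X + christoffel h (F u) ('d F u X) ('d F u Y)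
  - 'd F u (covd g (cst Y) u X).

Definition local_tension (R : realType) (d e : nat)
    (g : 'rV[R]_d -> 'M[R]_d) (h : 'rV[R]_e -> 'M[R]_e)
    (F : 'rV[R]_d -> 'rV[R]_e) (u : 'rV[R]_d) : 'rV[R]_e :=
  \sum_a \sum_b invmx (g u) a b *:
    second_fundamental_form g h F u (basis_vec a) (basis_vec b).

Section Fields.
Context {R : realType} {d : nat} (M : manifold R d).
Local Notation E := 'rV[R]_d.

Definition chart_image (i : atlas M) : set E := chart i @` chart_dom i.

(* differential at p of the change of coordinates from chart i to chart j *)
Definition transport (i j : atlas M) (p : M) (X : E) : E :=
  'd (chart j \o param i) (chart i p) X.

Definition smooth_field (W : normedModType R) (T : atlas M -> E -> W) : Prop :=
  forall i, smooth_on (chart_image i) (T i).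

Definition smooth_function (l : M -> R) : Prop :=
  smooth_field (fun i => l \o param i).

Definition is_vector_field (V : atlas M -> E -> E) : Prop :=
  smooth_field V /\
  forall i j p, chart_dom i p -> chart_dom j p ->
    V j (chart j p) = transport i j p (V i (chart i p)).

Definition is_one_form (w : atlas M -> E -> 'cV[R]_d) : Prop :=
  smooth_field w /\
  forall i j p, chart_dom i p -> chart_dom j p -> forall X,
    pairing (w j (chart j p)) (transport i j p X) = pairing (w i (chart i p)) X.

Definition is_endomorphism_field (F : atlas M -> E -> 'M[R]_d) : Prop :=
  smooth_field F /\
  forall i j p, chart_dom i p -> chart_dom j p -> forall X,
    transport i j p X *m F j (chart j p) = transport i j p (X *m F i (chart i p)).

Definition is_riemannian_metric (g : atlas M -> E -> 'M[R]_d) : Prop :=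
  [/\ smooth_field g,
      forall i u, chart_image i u -> posdef (g i u) &
      forall i j p, chart_dom i p -> chart_dom j p -> forall X Y,
        inner (g j (chart j p)) (transport i j p X) (transport i j p Y)
        = inner (g i (chart i p)) X Y].

End Fields.

Record almost_contact_metric (R : realType) (m : nat)
    (M : manifold R m.*2.+1) := AlmostContactMetric {
  phi : atlas M -> 'rV[R]_(m.*2.+1) -> 'M[R]_(m.*2.+1);
  xi : atlas M -> 'rV[R]_(m.*2.+1) -> 'rV[R]_(m.*2.+1);
  eta : atlas M -> 'rV[R]_(m.*2.+1) -> 'cV[R]_(m.*2.+1);
  metric : atlas M -> 'rV[R]_(m.*2.+1) -> 'M[R]_(m.*2.+1);
  phi_field : is_endomorphism_field phi;
  xi_field : is_vector_field xi;
  eta_field : is_one_form eta;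
  metric_field : is_riemannian_metric metric;
  phi_phi : forall i u, chart_image i u -> forall X,
    X *m phi i u *m phi i u = - X + pairing (eta i u) X *: xi i u;
  eta_xi : forall i u, chart_image i u -> pairing (eta i u) (xi i u) = 1;
  metric_phi : forall i u, chart_image i u -> forall X Y,
    inner (metric i u) (X *m phi i u) (Y *m phi i u)
    = inner (metric i u) X Y - pairing (eta i u) X * pairing (eta i u) Y
}.

Section Classes.
Context {R : realType} {m : nat} {M : manifold R m.*2.+1}.
Variable S : almost_contact_metric M.
Local Notation E := 'rV[R]_(m.*2.+1).

Definition nabla_phi (i : atlas M) (u X Y : E) : E :=
  covd_end (metric S i) (phi S i) u X Y.

Definition nabla_xi (i : atlas M) (u X : E) : E :=
  covd (metric S i) (xi S i) u X.

Definition P_tensor (i : atlas M) (u X Y : E) : E :=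
  nabla_phi i u X Y + nabla_phi i u (X *m phi S i u) (Y *m phi S i u).

(* {e_k; phi e_k; xi} as a family *)
Definition frame_vec (i : atlas M) (u : E) (e : 'I_m -> E)
    (a : option ('I_m + 'I_m)) : E :=
  match a with
  | Some (inl k) => e k
  | Some (inr k) => e k *m phi S i u
  | None => xi S i u
  end.

(* Orthonormal frames at the single point u: since P is a tensor, only the
   value of the frame at u matters in delta_Omega, and every such frame extends
   to a local one. *)
Definition adapted_frame (i : atlas M) (u : E) (e : 'I_m -> E) : Prop :=
  forall a b, inner (metric S i u) (frame_vec i u e a) (frame_vec i u e b)
              = (a == b)%:R.

Definition delta_Omega (i : atlas M) (u : E) (e : 'I_m -> E) (X : E) : R :=
  inner (metric S i u)
    (- (nabla_xi i u (xi S i u) *m phi S i u) + \sum_k P_tensor i u (e k) (e k)) X.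

Definition almost_semi_Sasakian : Prop :=
  forall i u, chart_image i u -> forall e, adapted_frame i u e ->
  forall X, delta_Omega i u e X = m.*2%:R * pairing (eta S i u) X.

Definition quasi_K_cosymplectic : Prop :=
  forall i u, chart_image i u -> forall X Y,
    P_tensor i u X Y = pairing (eta S i u) Y *: nabla_xi i u (X *m phi S i u).

Definition alpha_Sasakian (alpha : R) : Prop :=
  alpha != 0 /\
  forall i u, chart_image i u -> forall X Y,
    nabla_phi i u X Y
    = alpha *: (inner (metric S i u) X Y *: xi S i u - pairing (eta S i u) Y *: X).

(* d l (xi) = 0 on all of M *)
Definition xi_derivative_zero (l : M -> R) : Prop :=
  forall i p, chart_dom i p ->
    'd (l \o param i : E -> R) (chart i p) (xi S i (chart i p)) = 0.

End Classes.

Section Maps.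
Context {R : realType} {d e : nat} {M : manifold R d} {N : manifold R e}.
Variable f : M -> N.

Definition local_rep (i : atlas M) (j : atlas N) : 'rV[R]_d -> 'rV[R]_e :=
  chart j \o f \o param i.

Definition smooth_map : Prop :=
  continuous f /\
  forall i j,
    smooth_on (chart i @` (chart_dom i `&` f @^-1` chart_dom j)) (local_rep i j).

(* f_* X in the charts i and j *)
Definition tangent_map (i : atlas M) (j : atlas N) (p : M) (X : 'rV[R]_d) :
  'rV[R]_e := 'd (local_rep i j) (chart i p) X.

End Maps.

Section ContactMaps.
Context {R : realType} {m n : nat} {M : manifold R m.*2.+1}
  {N : manifold R n.*2.+1}.
Variables (S : almost_contact_metric M) (T : almost_contact_metric N) (f : M -> N).

Definition signed_holomorphic (s : R) : Prop :=
  forall i j p, chart_dom i p -> chart_dom j (f p) -> forall X,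
    tangent_map f i j p (X *m phi S i (chart i p))
    = s *: (tangent_map f i j p X *m phi T j (chart j (f p))).

Definition pm_holomorphic : Prop := signed_holomorphic 1 \/ signed_holomorphic (-1).

(* f_* xi = l gamma, where gamma is the structure vector field of N *)
Definition tangent_map_xi (l : M -> R) : Prop :=
  forall i j p, chart_dom i p -> chart_dom j (f p) ->
    tangent_map f i j p (xi S i (chart i p)) = l p *: xi T j (chart j (f p)).

Definition harmonic_map : Prop :=
  forall i j p, chart_dom i p -> chart_dom j (f p) ->
    local_tension (metric S i) (metric T j) (local_rep f i j) (chart i p) = 0.

End ContactMaps.

Section ChristoffelTheory.
Context {R : realType} {d : nat}.
Local Notation E := 'rV[R]_d.
Implicit Types (G : 'M[R]_d) (X Y Z : E).

Lemma innerDl G X Y Z : inner G (X + Y) Z = inner G X Z + inner G Y Z.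
Proof. by rewrite /inner !mulmxDl mxE. Qed.

Lemma innerDr G X Y Z : inner G X (Y + Z) = inner G X Y + inner G X Z.
Proof. by rewrite /inner raddfD /= mulmxDr mxE. Qed.

Lemma innerZl G a X Y : inner G (a *: X) Y = a * inner G X Y.
Proof. by rewrite /inner -!scalemxAl mxE. Qed.

Lemma innerZr G a X Y : inner G X (a *: Y) = a * inner G X Y.
Proof. by rewrite /inner linearZ /= -scalemxAr mxE. Qed.

Lemma inner_sym G X Y : G^T = G -> inner G X Y = inner G Y X.
Proof.
move=> GT; have -> : inner G X Y = (X *m G *m Y^T)^T 0 0 by rewrite mxE.
by rewrite !trmx_mul trmxK GT mulmxA.
Qed.

Lemma innerDm G G' X Y : inner (G + G') X Y = inner G X Y + inner G' X Y.
Proof. by rewrite /inner mulmxDr mulmxDl mxE. Qed.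

Lemma innerZm a G X Y : inner (a *: G) X Y = a * inner G X Y.
Proof. by rewrite /inner -scalemxAr -scalemxAl mxE. Qed.

Lemma posdef_unitmx G : posdef G -> G \in unitmx.
Proof.
move=> [_ Gpos]; rewrite -row_free_unit -kermx_eq0; apply/rowV0P => X.
rewrite sub_kermx => /eqP XG; apply/eqP/negPn/negP => /Gpos.
by rewrite /inner XG mul0mx mxE ltxx.
Qed.

Lemma inner_basis G X c : inner G X (basis_vec c) = (X *m G) 0 c.
Proof.
by rewrite /inner /basis_vec trmx_delta -colE mxE.
Qed.

Lemma inner_inj G X Y : posdef G ->
  (forall Z, inner G X Z = inner G Y Z) -> X = Y.
Proof.
move=> /posdef_unitmx Gu XY; apply: (can_inj (mulmxK Gu)).
by apply/rowP => c; rewrite -!inner_basis XY.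
Qed.

Section AtPoint.
Variables (g : E -> 'M[R]_d) (u : E).
Hypotheses (dg : differentiable g u) (gpos : posdef (g u)).
Hypothesis gsym : \forall v \near u, (g v)^T = g v.

Lemma dmetric_sym Z : ('d g u Z)^T = 'd g u Z.
Proof.
have dgZ : derivable g u Z by exact: diff_derivable.
rewrite -deriveE// derive_mx//; apply/matrixP => a b; rewrite !mxE.
apply: near_eq_derive; near=> v; rewrite -[in RHS](near gsym v)// mxE.
Unshelve. all: by end_near. Qed.

(* Koszul formula *)
Lemma inner_christoffel X Y Z :
  inner (g u) (christoffel g u X Y) Z =
  2^-1 * (inner ('d g u X) Y Z + inner ('d g u Y) X Z - inner ('d g u Z) X Y).
Proof.
rewrite [Z]row_sum_delta.
elim/big_rec: _ => [|c W _ IH].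
  by rewrite linear0 /inner linear0 !mulmx0 mul0mx !mxE addr0 subr0 mulr0.
rewrite linearD linearZ /= !(innerDr, innerZr, innerDm, innerZm) IH.
rewrite inner_basis /christoffel -!scalemxAl mulmxKV ?posdef_unitmx// !mxE.
rewrite -/(basis_vec c); ring.
Qed.

Lemma christoffelC X Y : christoffel g u X Y = christoffel g u Y X.
Proof.
apply: (inner_inj gpos) => Z; rewrite !inner_christoffel.
by rewrite (inner_sym X Y (dmetric_sym Z)) [_ + inner _ X Z]addrC.
Qed.

Lemma christoffel_metric X Y Z :
  inner ('d g u Z) X Y =
  inner (g u) (christoffel g u Z X) Y + inner (g u) X (christoffel g u Z Y).
Proof.
rewrite [inner (g u) X _]inner_sym; last by case: gpos.
rewrite !inner_christoffel (inner_sym Y X (dmetric_sym Z)).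
by field.
Qed.

Lemma christoffel_unique (B : E -> E -> E) :
  (forall X Y, B X Y = B Y X) ->
  (forall X Y Z, inner ('d g u Z) X Y =
                 inner (g u) (B Z X) Y + inner (g u) X (B Z Y)) ->
  forall X Y, B X Y = christoffel g u X Y.
Proof.
move=> BC Bg X Y; apply: (inner_inj gpos) => Z.
have gT : (g u)^T = g u by case: gpos.
rewrite inner_christoffel !Bg !(inner_sym _ (B _ _) gT).
rewrite (BC Y X) (BC Z X) (BC Z Y).
by field.
Qed.

End AtPoint.

End ChristoffelTheory.

(* Main.v *)
(* Write B for the second fundamental form of f and s = 1 or -1 for the sign with
   df phi = s phi' df.  Differentiating this relation gives
     B(X, phi Y) + df((nabla_X phi) Y) = s (phi' B(X, Y) + (nabla'_(df X) phi') (df Y)).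
   Summing over an adapted frame {e; phi e; xi}, the left-hand terms B(e, phi e)
   and B(phi e, phi phi e) cancel and sum (nabla_E phi) E = 2m xi, so that
     2m df(xi) = s (phi' tau + sum P'(df e, df e) + (nabla'_(df xi) phi') (df xi)).
   In both classes the last two terms are multiples of gamma, hence phi'^2 tau = 0
   and tau is a multiple of gamma.  (In the first class they vanish, so df(xi) = 0
   when m > 0.)  The gamma-component comes from differentiating
   h(df Y, gamma) = lambda eta(Y) and tracing:
     sigma(tau) + sum h(df E, nabla'_(df E) gamma) = d lambda(xi) + lambda div xi.
   The sum vanishes in both classes, and div xi = 0 because 2m xi = div phi with
   phi skew, so that div (div phi) = 0 (for m = 0 use |xi| = 1). *)

From HB Require Import structures.
Require Import Defs.
From mathcomp Require Import all_boot all_order all_algebra.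
From mathcomp Require Import all_classical all_reals all_analysis.
From mathcomp Require Import ring lra zify.

Set Implicit Arguments.
Unset Strict Implicit.
Unset Printing Implicit Defensive.

Import Order.TTheory GRing.Theory Num.Theory.
Import numFieldNormedType.Exports.

Local Open Scope classical_set_scope.
Local Open Scope ring_scope.

(** * Calculus of matrix-valued functions *)

(* Sealed copy of ['d f x X]: when a match on the latter fails, unification goes
   on to unfold [diff], practically without end. *)
HB.lock Definition frechet {R : realType} {V W : normedModType R}
  (f : V -> W) (x X : V) : W := 'd f x X.

Section Frechet.
Context {R : realType} {V W : normedModType R}.
Implicit Types (f g : V -> W) (x X Y : V).

Lemma frechetE f x X : frechet f x X = 'd f x X.
Proof. by rewrite frechet.unlock. Qed.

Lemma frechetP f x : linear (frechet f x).
Proof. by move=> a X Y; rewrite !frechetE linearP. Qed.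

Lemma frechet_cst (c : W) x X : frechet (fun=> c) x X = 0.
Proof. by rewrite frechetE diff_cst. Qed.

Lemma frechetD f g x X : differentiable f x -> differentiable g x ->
  frechet (fun v => f v + g v) x X = frechet f x X + frechet g x X.
Proof. by move=> df dg; rewrite !frechetE -[LHS]/('d (f + g) x X) (diffD df dg). Qed.

End Frechet.

Lemma frechet_comp (R : realType) (V W U : normedModType R) (f : V -> W) (h : W -> U) x X :
  differentiable f x -> differentiable h (f x) ->
  frechet (fun v => h (f v)) x X = frechet h (f x) (frechet f x X).
Proof.
move=> df dh; rewrite !frechetE.
by rewrite -[LHS]/('d (h \o f) x X) (diff_comp df dh).
Qed.

(** * Locality of the differential *)

Section DiffNear.
Context {R : realType} {V W : normedModType R}.
Implicit Types f g : V -> W.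

(** Near [x] the remainders of the first-order expansions of [f] and [g] coincide, so ['d f x] also
    expands [g], and a differential is unique. *)
Lemma near_eq_is_diff f g (x : V) :
  (\forall v \near x, f v = g v) -> differentiable f x ->
  differentiable g x /\ 'd g x = 'd f x :> (V -> W).
Proof.
move=> fg df; have [cdf /eqaddoP fo] := (diff_locallyP x f).1 df.
have go : g \o shift x = cst (g x) + 'd f x +o_ 0 id.
  apply/eqaddoP => e e0.
  have fg0 : \forall h \near (0 : V), f (h + x) = g (h + x).
    by move: fg; rewrite (near_shift 0) /= ; apply: filterS => y /=; rewrite subr0.
  near=> h.
  have -> : (g \o shift x - (cst (g x) + 'd f x)) h
          = (f \o shift x - (cst (f x) + 'd f x)) h.
    rewrite !fctE /= -(nbhs_singleton fg); congr (_ - _).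
    by rewrite [RHS](near fg0).
  by near: h; exact: fo.
have E := diff_unique cdf go.
split; last exact: E.
by apply/diff_locallyP; rewrite E; split.
Unshelve. all: by end_near. Qed.

Lemma near_eq_differentiable f g (x : V) :
  (\forall v \near x, f v = g v) -> differentiable f x -> differentiable g x.
Proof. by move=> fg /(near_eq_is_diff fg)[]. Qed.

Lemma near_eq_frechet f g (x : V) :
  (\forall v \near x, f v = g v) -> differentiable f x ->
  forall X, frechet g x X = frechet f x X.
Proof. by move=> fg /(near_eq_is_diff fg)[_ E] X; rewrite !frechetE E. Qed.

End DiffNear.

(** * Products, determinants, inverses and inner products of matrix-valued functions *)

Section DiffMatrix.
Context {R : realType} {V : normedModType R}.

Lemma differentiable_entry m n (A : V -> 'M[R]_(m, n)) x i j :
  differentiable A x -> differentiable (fun v => A v i j) x.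
Proof.
move=> dA; apply: (@differentiable_comp _ _ _ _ A (fun N : 'M[R]_(m, n) => N i j)) => //.
exact: differentiable_coord.
Qed.

Lemma differentiable_mx m n (A : V -> 'M[R]_(m, n)) x :
  (forall i j, differentiable (fun v => A v i j) x) -> differentiable A x.
Proof.
move=> dA.
have -> : A = \sum_i \sum_j (fun v => A v i j *: delta_mx i j).
  apply/funext => v; rewrite fct_sumE [LHS]matrix_sum_delta.
  by apply: eq_bigr => i _; rewrite fct_sumE.
apply: differentiable_sum => i; apply: differentiable_sum => j.
exact: differentiableZl.
Qed.

Lemma frechet_entry m n (A : V -> 'M[R]_(m, n)) x X i j :
  differentiable A x -> frechet A x X i j = frechet (fun v => A v i j) x X.
Proof.
move=> dA; rewrite !frechetE -!deriveE//; last exact: differentiable_entry.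
by rewrite derive_mx ?mxE//; exact: diff_derivable.
Qed.

Lemma differentiable_mulmx m n p (A : V -> 'M[R]_(m, n)) (B : V -> 'M[R]_(n, p)) x :
  differentiable A x -> differentiable B x ->
  differentiable (fun v => A v *m B v) x.
Proof.
move=> dA dB; apply: differentiable_mx => i j.
have -> : (fun v => (A v *m B v) i j) = \sum_k (fun v => A v i k * B v k j).
  by apply/funext => v; rewrite fct_sumE mxE.
apply: differentiable_sum => k.
by apply: differentiableM; exact: differentiable_entry.
Qed.

Lemma frechet_mulmx m n p (A : V -> 'M[R]_(m, n)) (B : V -> 'M[R]_(n, p)) x X :
  differentiable A x -> differentiable B x ->
  frechet (fun v => A v *m B v) x X = frechet A x X *m B x + A x *m frechet B x X.
Proof.
move=> dA dB; apply/matrixP => i j.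
have dAE i' j' := @differentiable_entry _ _ A x i' j' dA.
have dBE i' j' := @differentiable_entry _ _ B x i' j' dB.
have dAB := differentiable_mulmx dA dB.
rewrite (frechet_entry _ _ _ dAB) frechetE -(deriveE _ (differentiable_entry _ _ dAB)).
have -> : (fun v => (A v *m B v) i j) = \sum_k (fun v => A v i k * B v k j).
  by apply/funext => v; rewrite fct_sumE mxE.
rewrite derive_sum; last first.
  by move=> k; apply: derivableM; exact: diff_derivable.
rewrite 3!mxE -big_split /=; apply: eq_bigr => k _.
rewrite deriveM; [|exact: diff_derivable (dAE _ _)|exact: diff_derivable (dBE _ _)].
rewrite (deriveE _ (dAE _ _)) (deriveE _ (dBE _ _)).
rewrite (frechet_entry _ _ _ dA) (frechet_entry _ _ _ dB) !frechetE.
by rewrite addrC; congr (_ + _); rewrite /GRing.scale /= mulrC.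
Qed.

Lemma differentiable_det n (A : V -> 'M[R]_n) x :
  differentiable A x -> differentiable (fun v => \det (A v)) x.
Proof.
move=> dA.
have dprod (s : seq 'I_n) (F : 'I_n -> V -> R) :
    (forall i, differentiable (F i) x) ->
    differentiable (fun v => \prod_(i <- s) F i v) x.
  move=> dF; elim: s => [|i s IH].
    by under eq_fun do rewrite big_nil; exact: differentiable_cst.
  under eq_fun do rewrite big_cons.
  exact: differentiableM.
rewrite /determinant.
(* The Leibniz sum over permutations is generalised to a sum over an arbitrary list, which allows
   induction. *)
elim: (index_enum _) => [|s l IH].
  by under eq_fun do rewrite big_nil; exact: differentiable_cst.
under eq_fun do rewrite big_cons.
apply: differentiableD => //; apply: differentiableM.
  exact: differentiable_cst.
by apply: dprod => i; exact: differentiable_entry.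
Qed.

Lemma differentiable_adj n (A : V -> 'M[R]_n) x :
  differentiable A x -> differentiable (fun v => \adj (A v)) x.
Proof.
move=> dA; apply: differentiable_mx => i j.
under eq_fun do rewrite mxE /cofactor.
apply: differentiableM; first exact: differentiable_cst.
apply: differentiable_det; apply: differentiable_mx => k l.
by under eq_fun do rewrite !mxE; exact: differentiable_entry.
Qed.

Lemma near_unitmx n (A : V -> 'M[R]_n) x :
  differentiable A x -> A x \in unitmx -> \forall v \near x, A v \in unitmx.
Proof.
move=> dA; rewrite unitmxE unitfE => A0.
have /differentiable_continuous cdet := differentiable_det dA.
have : \forall v \near x, \det (A v) != 0 by exact: cvgr_neq0 cdet A0.
by apply: filterS => v Av; rewrite unitmxE unitfE.
Qed.

Lemma differentiable_invmx n (A : V -> 'M[R]_n) x :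
  differentiable A x -> A x \in unitmx ->
  differentiable (fun v => invmx (A v)) x.
Proof.
move=> dA Au; have nAu := near_unitmx dA Au.
(* [invmx] follows Cramer's rule only on invertible matrices and returns its argument elsewhere, so
   the formula is used on the neighbourhood [nAu]. *)
apply: (@near_eq_differentiable _ _ _ (fun v => (\det (A v))^-1 *: \adj (A v))).
  by apply: filterS nAu => v Av; rewrite /invmx Av.
apply: differentiable_mx => i j; under eq_fun do rewrite mxE.
apply: differentiableM; last by apply: differentiable_entry; exact: differentiable_adj.
apply: differentiableV; first exact: differentiable_det.
by move: Au; rewrite unitmxE unitfE.
Qed.

(** Differentiate [invmx (A v) *m A v = 1%:M], valid near [x], and solve for the derivative of the
    inverse. *)
Lemma frechet_invmx n (A : V -> 'M[R]_n) x X :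
  differentiable A x -> A x \in unitmx ->
  frechet (fun v => invmx (A v)) x X = - (invmx (A x) *m frechet A x X *m invmx (A x)).
Proof.
move=> dA Au; have dI := differentiable_invmx dA Au.
have E : frechet (fun v => invmx (A v) *m A v) x X = 0.
  have H : \forall v \near x, cst 1%:M v = invmx (A v) *m A v.
    by apply: filterS (near_unitmx dA Au) => v Av; rewrite mulVmx.
  by rewrite (near_eq_frechet H) ?frechet_cst//; exact: differentiable_cst.
rewrite frechet_mulmx// in E; move/eqP: E; rewrite addr_eq0 => /eqP E.
by rewrite -[LHS](mulmxK Au) E mulNmx.
Qed.

Lemma frechet_mulmxl m n p (C : 'M[R]_(m, n)) (A : V -> 'M[R]_(n, p)) x X :
  differentiable A x -> frechet (fun v => C *m A v) x X = C *m frechet A x X.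
Proof.
move=> dA; rewrite (@frechet_mulmx _ _ _ (fun=> C) A)//.
by rewrite frechet_cst mul0mx add0r.
Qed.

Lemma frechet_mulmxr m n p (C : 'M[R]_(n, p)) (A : V -> 'M[R]_(m, n)) x X :
  differentiable A x -> frechet (fun v => A v *m C) x X = frechet A x X *m C.
Proof.
move=> dA; rewrite (@frechet_mulmx _ _ _ A (fun=> C))//.
by rewrite frechet_cst mulmx0 addr0.
Qed.

Lemma differentiable_trmx m n (A : V -> 'M[R]_(m, n)) x :
  differentiable A x -> differentiable (fun v => (A v)^T) x.
Proof.
move=> dA; apply: differentiable_mx => i j; under eq_fun do rewrite mxE.
exact: differentiable_entry.
Qed.

Lemma frechet_trmx m n (A : V -> 'M[R]_(m, n)) x X :
  differentiable A x -> frechet (fun v => (A v)^T) x X = (frechet A x X)^T.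
Proof.
move=> dA; apply/matrixP => i j.
rewrite (frechet_entry _ _ _ (differentiable_trmx dA)) mxE (frechet_entry _ _ _ dA).
by under eq_fun do rewrite mxE.
Qed.

Lemma differentiable_inner d (G : V -> 'M[R]_d) (A B : V -> 'rV[R]_d) x :
  differentiable G x -> differentiable A x -> differentiable B x ->
  differentiable (fun v => inner (G v) (A v) (B v)) x.
Proof.
move=> dG dA dB; apply: differentiable_entry.
exact: differentiable_mulmx (differentiable_mulmx dA dG) (differentiable_trmx dB).
Qed.

Lemma frechet_inner d (G : V -> 'M[R]_d) (A B : V -> 'rV[R]_d) x X :
  differentiable G x -> differentiable A x -> differentiable B x ->
  frechet (fun v => inner (G v) (A v) (B v)) x X =
  inner (frechet G x X) (A x) (B x) + inner (G x) (frechet A x X) (B x)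
  + inner (G x) (A x) (frechet B x X).
Proof.
move=> dG dA dB; rewrite /inner.
have dAG := differentiable_mulmx dA dG.
have dBT := differentiable_trmx dB.
rewrite -(frechet_entry _ _ _ (differentiable_mulmx dAG dBT)).
rewrite (frechet_mulmx X dAG dBT) (frechet_mulmx X dA dG) (frechet_trmx X dB).
rewrite mulmxDl; have D (a b c : 'M[R]_1) : (a + b + c) 0 0 = b 0 0 + a 0 0 + c 0 0.
  by rewrite !mxE [a _ _ + _]addrC.
exact: D.
Qed.

Lemma frechetM (f g : V -> R) x X : differentiable f x -> differentiable g x ->
  frechet (fun v => f v * g v) x X = frechet f x X * g x + f x * frechet g x X.
Proof.
move=> df dg; rewrite !frechetE -[LHS]/('d (f * g) x X).
by rewrite (diffM df dg) addrC [in RHS]mulrC.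
Qed.

End DiffMatrix.

(** * Symmetry of second derivatives *)

Section SecondDerivative.
Context {R : realType} {V : normedModType R}.

(** Second derivatives are taken along a fixed vector, as in [Ck], so no norm on a space of linear
    maps is involved. *)
Definition twice_diff (W : normedModType R) (f : V -> W) (x : V) : Prop :=
  (\forall v \near x, differentiable f v) /\
  forall X, differentiable (fun v => frechet f v X) x.

Lemma twice_diff_diff (W : normedModType R) (f : V -> W) x :
  twice_diff f x -> differentiable f x.
Proof. by case=> /nbhs_singleton. Qed.

(* The second difference [f(u+tX+tY) - f(u+tX) - f(u+tY) + f(u)] is symmetric
   in X and Y, and by the mean value theorem it is
   [t^2 frechet (fun v => frechet f v X) u Y + o(t^2)]. *)
Lemma second_difference (f : V -> R) (u X Y : V) (e : R) :
  (\forall v \near u, differentiable f v) ->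
  differentiable (fun v => frechet f v X) u -> 0 < e ->
  \forall t \near (0 : R)^'+,
    `|f (u + t *: X + t *: Y) - f (u + t *: X) - f (u + t *: Y) + f u
      - t ^+ 2 * frechet (fun v => frechet f v X) u Y| <= e * t ^+ 2.
Proof.
rewrite frechet.unlock => ndf dG e0; set G := fun v => 'd f v X; set D := 'd G u.
(* For [a] and [b] between 0 and [t], the norm of [a *: X + b *: Y] is at most [t * C]; the summand
   1 keeps [C] positive. *)
pose C := `|X| + `|Y| + 1.
have C1 : 1 <= C by rewrite lerDr addr_ge0.
have C0 : 0 < C by exact: lt_le_trans C1.
(* Each of the two remainders below is at most [e / (2 * C) * (t * C)], half of [e * t]; the mean
   value theorem contributes the other factor [t]. *)
have e'0 : 0 < e / (2 * C) by rewrite divr_gt0// mulr_gt0.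
have ndf0 : \forall h \near (0 : V), differentiable f (u + h).
  by move: ndf; rewrite (near_shift 0) /=; apply: filterS => y /=; rewrite subr0 addrC.
have /eqaddoP/(_ _ e'0) oG := diff_locally dG.
have [d /= d0 Hd] := (nbhs_ballP _ _).1 (filterI ndf0 oG).
near=> t.
have t0 : 0 < t by near: t; exact: nbhs_right_gt.
have tC : t * C < d.
  by rewrite -ltr_pdivlMr//; near: t; apply: nbhs_right_lt; rewrite divr_gt0.
have small a b : 0 <= a <= t -> 0 <= b <= t ->
    `|a *: X + b *: Y| <= t * C /\ ball (0 : V) d (a *: X + b *: Y).
  move=> /andP[a0 at_] /andP[b0 bt].
  have H : `|a *: X + b *: Y| <= t * C.
    rewrite (le_trans (ler_normD _ _))// !normrZ !ger0_norm// /C !mulrDr mulr1.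
    by rewrite -[leLHS]addr0 !lerD// ?ler_wpM2r// ltW.
  by split=> //; rewrite -ball_normE /= sub0r normrN (le_lt_trans H).
have t1 : 0 <= t <= t by rewrite lexx ltW.
have t2 : 0 <= (0 : R) <= t by rewrite lexx ltW.
(* The second difference is [k t - k 0]. The vanishing multiple [0 *: Y] puts both points in the
   form covered by [small]. *)
pose k s := f (u + (s *: X + t *: Y)) - f (u + (s *: X + 0 *: Y)).
have daff b s : is_diff s (fun r : R => u + (r *: X + b *: Y)) (fun r => r *: X).
  apply: is_diff_eq; rewrite add0r addr0.
  by apply/funext => r.
have dk s : 0 <= s <= t ->
    is_derive s (1 : R) k (G (u + (s *: X + t *: Y)) - G (u + (s *: X + 0 *: Y))).
  move=> st.
  have dfa b : 0 <= b <= t ->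
      is_derive s (1 : R) (fun r => f (u + (r *: X + b *: Y))) (G (u + (s *: X + b *: Y))).
    move=> bt; have [_ /Hd[/= df _]] := small s b st bt.
    have da := daff b s.
    have dc : differentiable (f \o (fun r : R => u + (r *: X + b *: Y))) s.
      exact: differentiable_comp.
    apply: DeriveDef; first exact: diff_derivable.
    rewrite (deriveE _ dc) diff_comp// /= (@diff_val _ _ _ _ _ _ _ da) /= scale1r.
    by [].
  by apply: is_deriveB; exact: dfa.
have ck : {within `[0, t], continuous k}.
  apply: derivable_within_continuous => s; rewrite in_itv /= => st.
  by have [] := dk _ st.
have [c] := MVT_segment (ltW t0) (fun s st => dk s (subset_itv_oo_cc st)) ck.
rewrite in_itv /= subr0 => ct Ek.
have -> : f (u + t *: X + t *: Y) - f (u + t *: X) - f (u + t *: Y) + f u = k t - k 0.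
  by rewrite /k !scale0r !addr0 !add0r !addrA opprB addrA [LHS]addrAC.
rewrite Ek.
(* [G] is expanded at [u] towards both points at the intermediate parameter [c]; the two linear
   parts differ by [t * D Y], the main term. *)
have [S1 /Hd[_ /= /[!fctE] O1]] := small c t ct t1.
have [S2 /Hd[_ /= /[!fctE] O2]] := small c 0 ct t2.
move: O1 O2; rewrite ![_ + u]addrC -/D.
set g1 := G _; set g2 := G (u + (c *: X + 0 *: Y)).
have DE b : D (c *: X + b *: Y) = c * D X + b * D Y.
  by rewrite linearD (linearZ_LR D c) (linearZ_LR D b).
have DE0 : D (c *: X + 0 *: Y) = c * D X by rewrite DE mul0r addr0.
move: (DE t) DE0; set p1 := D (_ + _); set p2 := D (_ + _) => -> -> O1 O2.
have -> : (g1 - g2) * t - t ^+ 2 * D Y =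
   t * ((g1 - (G u + (c * D X + t * D Y))) - (g2 - (G u + c * D X))).
  by move: (D X) (D Y) (G u) g1 g2 => *; ring.
rewrite normrM (ger0_norm (ltW t0)) expr2 mulrCA ler_pM2l//.
rewrite (le_trans (ler_normB _ _))//.
apply: (@le_trans _ _ (e / (2 * C) * (t * C) + e / (2 * C) * (t * C))).
  by apply: lerD; [apply: (le_trans O1)|apply: (le_trans O2)]; rewrite ler_pM2l.
rewrite le_eqVlt; apply/orP; left; apply/eqP; field.
by rewrite gt_eqF.
Unshelve. all: by end_near. Qed.

(** Both mixed derivatives, scaled by [t ^+ 2], lie within [e / 2 * t ^+ 2] of the same second
    difference, for every positive [e]. *)
Lemma diff2C (f : V -> R) (u X Y : V) : twice_diff f u ->
  frechet (fun v => frechet f v X) u Y = frechet (fun v => frechet f v Y) u X.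
Proof.
move=> [ndf dG]; apply/eqP; rewrite -subr_eq0 -normr_le0.
set a := frechet _ u Y; set b := frechet _ u X.
apply/ler_addgt0Pl => e e0; rewrite addr0.
have e20 : 0 < e / 2 by rewrite divr_gt0.
have HX := second_difference Y ndf (dG X) e20.
have HY := second_difference X ndf (dG Y) e20.
near (0 : R)^'+ => t.
have t0 : 0 < t by near: t; exact: nbhs_right_gt.
have tt : 0 < t ^+ 2 by rewrite exprn_gt0.
have := near HX t; have := near HY t.
rewrite -/a -/b (addrAC u (t *: Y)) => /(_ _)/wrap[] // H1 /(_ _)/wrap[]// H2.
rewrite -(ler_pM2l tt) -[X in X * `|_|](ger0_norm (ltW tt)) -normrM.
have := lerD H1 H2; rewrite -mulrDl -splitr [e * _]mulrC; apply: le_trans.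
apply: le_trans (ler_normB _ _).
rewrite le_eqVlt; apply/orP; left; apply/eqP; congr `|_|.
by move: (f _) (f _) (f _) (f _) => *; ring.
Unshelve. all: by end_near. Qed.

End SecondDerivative.

(** * Second derivatives of matrix-valued functions and of Jacobians *)

Section TwiceDiffMatrix.
Context {R : realType} {V : normedModType R}.

Lemma diff2_mxC m n (A : V -> 'M[R]_(m, n)) u X Y : twice_diff A u ->
  frechet (fun v => frechet A v X) u Y = frechet (fun v => frechet A v Y) u X.
Proof.
move=> [ndA ddA]; apply/matrixP => i j.
have E Z : \forall v \near u, frechet A v Z i j = frechet (fun w => A w i j) v Z.
  by apply: filterS ndA => v dA; exact: frechet_entry.
have dE Z := differentiable_entry i j (ddA Z).
have dE' Z := near_eq_differentiable (E Z) (dE Z).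
rewrite (frechet_entry _ _ _ (ddA X)) (frechet_entry _ _ _ (ddA Y)).
rewrite -(near_eq_frechet (E X) (dE X)) -(near_eq_frechet (E Y) (dE Y)).
apply: diff2C; split; last exact: dE'.
by apply: filterS ndA => v; exact: differentiable_entry.
Qed.

Lemma twice_diff_mulmx m n p (A : V -> 'M[R]_(m, n)) (B : V -> 'M[R]_(n, p)) x :
  twice_diff A x -> twice_diff B x -> twice_diff (fun v => A v *m B v) x.
Proof.
move=> tA tB; have [nA ddA] := tA; have [nB ddB] := tB; split.
  by apply: filterS2 nA nB => v; exact: differentiable_mulmx.
move=> X; apply: (@near_eq_differentiable _ _ _
    (fun v => frechet A v X *m B v + A v *m frechet B v X)).
  by apply: filterS2 nA nB => v dA dB; exact/esym/frechet_mulmx.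
by apply: differentiableD; apply: differentiable_mulmx => //; exact: twice_diff_diff.
Qed.

Lemma twice_diff_invmx n (A : V -> 'M[R]_n) x :
  twice_diff A x -> A x \in unitmx -> twice_diff (fun v => invmx (A v)) x.
Proof.
move=> tA Au; have [nA ddA] := tA; have dA := twice_diff_diff tA.
have nAu := near_unitmx dA Au; have dI := differentiable_invmx dA Au; split.
  by apply: filterS2 nA nAu => v; exact: differentiable_invmx.
move=> X; apply: (@near_eq_differentiable _ _ _
    (fun v => - (invmx (A v) *m frechet A v X *m invmx (A v)))).
  by apply: filterS2 nA nAu => v dAv Av; exact/esym/frechet_invmx.
by apply: differentiableN; do 2!apply: differentiable_mulmx => //.
Qed.

Lemma smooth_on_twice_diff (W : normedModType R) (U : set V) (f : V -> W) x :
  open U -> smooth_on U f -> U x -> twice_diff f x.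
Proof.
move=> oU /(_ 2)[df ddf] Ux; rewrite /twice_diff frechet.unlock.
split; last by move=> X; apply: (ddf X).1.
by apply: filterS (open_nbhs_nbhs (conj oU Ux)) => v; exact: df.
Qed.

End TwiceDiffMatrix.

Section Jacobian.
Context {R : realType} {d e : nat}.
Variables (F : 'rV[R]_d -> 'rV[R]_e) (u : 'rV[R]_d).

Lemma mul_jacobian v X : X *m jacobian F v = frechet F v X.
Proof. by rewrite frechetE; exact: mul_rV_lin1. Qed.

Hypothesis dF : twice_diff F u.

Lemma differentiable_jacobian : differentiable (jacobian F) u.
Proof.
apply: differentiable_mx => i j.
have -> : (fun v => jacobian F v i j) = (fun v => frechet F v (delta_mx 0 i) 0 j).
  by apply/funext => v; rewrite mxE frechetE.
exact: differentiable_entry (dF.2 _).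
Qed.

(** The Jacobian acts on row vectors from the right, so the second derivative becomes a matrix
    product, visibly linear in [Y]. *)
Lemma frechet_jacobian X Y :
  frechet (fun v => frechet F v Y) u X = Y *m frechet (jacobian F) u X.
Proof.
rewrite -frechet_mulmxl; last exact: differentiable_jacobian.
by under eq_fun do rewrite -mul_jacobian.
Qed.

End Jacobian.

(** * Almost contact structures and adapted frames *)

Section InnerTheory.
Context {R : realType} {d : nat}.
Local Notation E := 'rV[R]_d.
Implicit Types (G : 'M[R]_d) (X Y Z : E) (w : 'cV[R]_d).

Lemma inner0l G Y : inner G 0 Y = 0.
Proof. by rewrite /inner !mul0mx mxE. Qed.

Lemma inner0r G X : inner G X 0 = 0.
Proof. by rewrite /inner linear0 mulmx0 mxE. Qed.

Lemma innerNl G X Y : inner G (- X) Y = - inner G X Y.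
Proof. by rewrite -scaleN1r innerZl mulN1r. Qed.

Lemma innerNr G X Y : inner G X (- Y) = - inner G X Y.
Proof. by rewrite -scaleN1r innerZr mulN1r. Qed.

Lemma inner_suml (I : Type) (r : seq I) (F : I -> E) G Y :
  inner G (\sum_(k <- r) F k) Y = \sum_(k <- r) inner G (F k) Y.
Proof.
elim: r => [|k r IH]; first by rewrite !big_nil inner0l.
by rewrite !big_cons innerDl IH.
Qed.

Lemma pairingD w X Y : pairing w (X + Y) = pairing w X + pairing w Y.
Proof. by rewrite /pairing mulmxDl mxE. Qed.

Lemma pairingZ w a X : pairing w (a *: X) = a * pairing w X.
Proof. by rewrite /pairing -scalemxAl mxE. Qed.

Lemma pairing0 w : pairing w 0 = 0.
Proof. by rewrite /pairing mul0mx mxE. Qed.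

Lemma pairingN w X : pairing w (- X) = - pairing w X.
Proof. by rewrite -scaleN1r pairingZ mulN1r. Qed.

Lemma linear_rowE (W : lmodType R) (f : E -> W) (X : E) :
  linear f -> f X = \sum_a X 0 a *: f (basis_vec a).
Proof.
move=> fl; pose fM := GRing.isLinear.Build _ _ _ _ f fl.
pose fL : {linear E -> W} := HB.pack f fM.
rewrite -[f]/(fL : _ -> _) {1}[X]row_sum_delta linear_sum.
by apply: eq_bigr => a _; rewrite linearZ.
Qed.

End InnerTheory.

Lemma big_option (A : nmodType) (T : finType) (F : option T -> A) :
  \sum_c F c = F None + \sum_t F (Some t).
Proof.
by rewrite ![index_enum _]unlock [@Finite.enum in LHS]unlock/= big_cons big_map.
Qed.

(** * Pointwise algebra of almost contact metric structures *)

Section ContactPoint.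
Context {R : realType} {m : nat} {M : manifold R m.*2.+1}.
Variables (S : almost_contact_metric M) (i : atlas M) (u : 'rV[R]_(m.*2.+1)).
Hypothesis Hu : chart_image i u.
Local Notation E := 'rV[R]_(m.*2.+1).
Local Notation G := (metric S i u).
Local Notation P := (phi S i u).
Local Notation x := (xi S i u).
Local Notation w := (eta S i u).
Implicit Types X Y : E.

Lemma metric_posdef : posdef G.
Proof. by case: (metric_field S) => _ /(_ _ _ Hu). Qed.

Lemma innerC X Y : inner G X Y = inner G Y X.
Proof. by apply: inner_sym; case: metric_posdef. Qed.

(** As phi^2 xi = 0, the identity for phi^2 at phi xi gives phi xi = c xi with c = eta(phi xi). Then
    c^2 xi = phi^2 xi = 0, so c = 0. *)
Lemma xi_phi : x *m P = 0.
Proof.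
have xPP : x *m P *m P = 0 by rewrite phi_phi// eta_xi// scale1r addNr.
have := phi_phi S Hu (x *m P); rewrite xPP mul0mx => /esym/eqP.
rewrite addrC subr_eq0 => /eqP xP.
have : pairing w (x *m P) ^+ 2 *: x = 0.
  by rewrite expr2 -scalerA xP scalemxAl xP xPP.
move=> /(congr1 (pairing w)); rewrite pairingZ pairing0 eta_xi// mulr1.
by move=> /eqP; rewrite expf_eq0 /= => /eqP c0; rewrite -xP c0 scale0r.
Qed.

(** Computing phi^3 X as phi(phi^2 X) and as phi^2(phi X) gives results that differ by eta(phi X)
    xi. *)
Lemma eta_phi X : pairing w (X *m P) = 0.
Proof.
have := phi_phi S Hu (X *m P).
rewrite (phi_phi S Hu X) mulmxDl mulNmx -scalemxAl xi_phi scaler0 addr0.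
move=> /(congr1 (fun Z => pairing w (Z + X *m P))).
rewrite addNr pairing0 addrAC addNr add0r pairingZ eta_xi// mulr1.
exact: esym.
Qed.

(** This is [metric_phi] with xi as second argument, where phi xi = 0. *)
Lemma inner_xi X : inner G X x = pairing w X.
Proof.
apply/esym/eqP; rewrite -subr_eq0 -oppr_eq0 opprB -[pairing w X]mulr1 -(eta_xi S Hu).
by rewrite -metric_phi// xi_phi inner0r.
Qed.

Lemma inner_xi_xi : inner G x x = 1.
Proof. by rewrite inner_xi eta_xi. Qed.

Lemma inner_phi X Y : inner G (X *m P) Y = - inner G X (Y *m P).
Proof.
have := metric_phi S Hu X (Y *m P).
rewrite (phi_phi S Hu Y) eta_phi mulr0 subr0 innerDr innerNr innerZr.
by rewrite inner_xi eta_phi mulr0 addr0 => <-; rewrite opprK.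
Qed.

Lemma inner_phi_diag X : inner G X (X *m P) = 0.
Proof.
have : inner G X (X *m P) = - inner G X (X *m P).
  by rewrite {1}innerC inner_phi.
by move: (inner _ _ _) => a; lra.
Qed.

Lemma inner_xi_phi X : inner G (X *m P) x = 0.
Proof. by rewrite inner_xi eta_phi. Qed.

Lemma phi_eq0 X : X *m P = 0 -> X = pairing w X *: x.
Proof.
move=> XP; have := phi_phi S Hu X; rewrite XP mul0mx => /esym/eqP.
by rewrite addrC subr_eq0 => /eqP.
Qed.

End ContactPoint.

(** * Existence of adapted frames, and traces computed in them *)

Section AdaptedFrame.
Context {R : realType} {m : nat} {M : manifold R m.*2.+1}.
Variables (S : almost_contact_metric M) (i : atlas M) (u : 'rV[R]_(m.*2.+1)).
Hypothesis Hu : chart_image i u.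
Local Notation E := 'rV[R]_(m.*2.+1).
Local Notation G := (metric S i u).
Local Notation P := (phi S i u).
Local Notation x := (xi S i u).

(** Indexing by [nat] keeps the type of the family fixed while it is lengthened. Orthonormality of
    the vectors phi e_a then follows from [metric_phi]. *)
Let partial_frame k (e : nat -> E) :=
  forall a b, (a < k)%N -> (b < k)%N ->
  [/\ inner G (e a) (e b) = (a == b)%:R, inner G (e a) (e b *m P) = 0 &
      inner G (e a) x = 0].

(** The conditions on [X] are the 2k + 1 columns of [C]. They are fewer than the dimension 2m + 1,
    so a nonzero solution exists. *)
Let orthogonal_vec k (e : nat -> E) : (k < m)%N ->
  exists2 X, X != 0 & (inner G X x = 0 /\
    forall a, (a < k)%N -> inner G X (e a) = 0 /\ inner G X (e a *m P) = 0).
Proof.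
move=> km.
pose A : 'M[R]_(k, _) := \matrix_(a < k) e a.
pose C := G *m (col_mx x (col_mx A (A *m P)))^T.
have : kermx C != 0.
  rewrite kermx_eq0 /row_free; apply: contraTneq (rank_leq_col C) => ->.
  rewrite -ltnNge; lia.
move=> /rowV0Pn[X /sub_kermxP XC X0]; exists X => //.
move: XC; rewrite mulmxA !tr_col_mx !mul_mx_row => /eqP.
rewrite row_mx_eq0 => /andP[/eqP X1]; rewrite row_mx_eq0 => /andP[/eqP X2 /eqP X3].
split=> [|a ak]; first by rewrite /inner X1 mxE.
split.
  have := congr1 (fun Z : 'rV_k => Z 0 (Ordinal ak)) X2; rewrite !mxE => <-.
  by rewrite /inner mxE; apply: eq_bigr => j _; rewrite !mxE.
have := congr1 (fun Z : 'rV_k => Z 0 (Ordinal ak)) X3; rewrite !mxE => <-.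
rewrite /inner mxE; apply: eq_bigr => j _; congr (_ * _).
rewrite [LHS]mxE [RHS]mxE !mxE; apply: eq_bigr => l _; by rewrite mxE.
Qed.

Let partial_frame_exists k : (k <= m)%N -> exists e, partial_frame k e.
Proof.
elim: k => [_|k IH km]; first by exists (fun=> 0).
have [e He] := IH (ltnW km); have [X X0 [Xx Xe]] := orthogonal_vec e km.
have [Gs /(_ _ X0) XX] := metric_posdef S Hu.
pose Z := (Num.sqrt (inner G X X))^-1 *: X.
have ZZ : inner G Z Z = 1.
  rewrite innerZl innerZr mulrA -expr2 exprVn sqr_sqrtr ?ltW//.
  by rewrite mulVf// gt_eqF.
have Zx : inner G Z x = 0 by rewrite innerZl Xx mulr0.
have Ze a : (a < k)%N -> inner G Z (e a) = 0 /\ inner G Z (e a *m P) = 0.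
  by move=> /Xe[X1 X2]; rewrite !innerZl X1 X2 mulr0.
exists (fun a => if a == k then Z else e a) => a b; rewrite !ltnS => ak bk.
case: (eqVneq a k) (eqVneq b k) => [ea|ak'] [eb|bk'].
- by rewrite ea eb eqxx ZZ inner_phi_diag.
- have [|Z1 Z2] := Ze b; first by rewrite ltn_neqAle bk'.
  by rewrite ea Z1 Z2 eq_sym (negbTE bk').
- have ak2 : (a < k)%N by rewrite ltn_neqAle ak'.
  have [Z1 Z2] := Ze a ak2; have [_ _ ex] := He a a ak2 ak2.
  rewrite eb (negbTE ak') ex -[X in [/\ _, X = _ & _]]opprK -inner_phi// !(innerC S Hu (e a)).
  by rewrite Z1 (innerC S Hu _ Z) Z2 oppr0.
- by apply: He; rewrite ltn_neqAle ?ak' ?bk'.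
Qed.

Lemma adapted_frame_exists : exists e : 'I_m -> E, adapted_frame S i u e.
Proof.
have [e He] := partial_frame_exists (leqnn m).
exists (fun k => e k) => a b.
have H1 (k l : 'I_m) : inner G (e k) (e l) = (k == l)%:R.
  by have [-> _ _] := He k l (ltn_ord k) (ltn_ord l).
have H2 (k l : 'I_m) : inner G (e k) (e l *m P) = 0.
  by have [_ -> _] := He k l (ltn_ord k) (ltn_ord l).
have H3 (k : 'I_m) : inner G (e k) x = 0.
  by have [_ _ ->] := He k k (ltn_ord k) (ltn_ord k).
case: a b => [[k|k]|] [[l|l]|]; rewrite /frame_vec /=.
- by rewrite H1.
- by rewrite H2.
- by rewrite H3.
- by rewrite innerC// H2.
- by rewrite metric_phi// -!inner_xi// !H3 mulr0 subr0 H1.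
- by rewrite inner_xi_phi.
- by rewrite innerC// H3.
- by rewrite innerC// inner_xi_phi.
- by rewrite inner_xi_xi.
Qed.

Variable e : 'I_m -> E.
Hypothesis He : adapted_frame S i u e.

(** With the frame as rows of [A], orthonormality reads A G A^T = 1, whence G^-1 = A^T A. *)
Lemma invmx_frame a b :
  invmx G a b = \sum_c frame_vec S i u e c 0 a * frame_vec S i u e c 0 b.
Proof.
pose I := option ('I_m + 'I_m).
have cI : m.*2.+1 = #|{: I}|.
  by rewrite card_option card_sum card_ord addnn.
pose f (j : 'I_(m.*2.+1)) : I := enum_val (cast_ord cI j).
pose A : 'M[R]_(m.*2.+1) := \matrix_j frame_vec S i u e (f j).
have finj : injective f by move=> j k /enum_val_inj/cast_ord_inj.
have AGA : A *m (G *m A^T) = 1%:M.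
  apply/matrixP => j k; rewrite mulmxA !mxE -(inj_eq finj) -He.
  rewrite /inner mxE; apply: eq_bigr => l _; rewrite !mxE; congr (_ * _).
  by apply: eq_bigr => q _; rewrite !mxE.
have := mulmx1C AGA; rewrite -mulmxA => GAA.
have -> : invmx G = A^T *m A.
  by rewrite -[RHS](mulKmx (posdef_unitmx (metric_posdef S Hu))) GAA mulmx1.
rewrite mxE [RHS](reindex f) /=.
  by apply: eq_bigr => j _; rewrite !mxE.
exists (fun c => cast_ord (esym cI) (enum_rank c)) => c _ /=.
  by rewrite /f enum_valK cast_ordK.
by rewrite /f cast_ordKV enum_rankK.
Qed.

(** Links coordinate traces, as in [local_tension], to frames: expand the frame vectors in the
    coordinate basis and use [invmx_frame]. *)
Lemma trace_frame (W : lmodType R) (B : E -> E -> W) :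
  (forall X, linear (B X)) -> (forall Y, linear (B^~ Y)) ->
  \sum_a \sum_b invmx G a b *: B (basis_vec a) (basis_vec b)
  = \sum_c B (frame_vec S i u e c) (frame_vec S i u e c).
Proof.
move=> Bl Br.
transitivity (\sum_c \sum_a \sum_b
    (frame_vec S i u e c 0 a * frame_vec S i u e c 0 b) *: B (basis_vec a) (basis_vec b)).
  rewrite [RHS]exchange_big; apply: eq_bigr => a _.
  rewrite [RHS]exchange_big; apply: eq_bigr => b _.
  by rewrite invmx_frame scaler_suml.
apply: eq_bigr => c _; rewrite [RHS](linear_rowE _ (Br _)).
apply: eq_bigr => a _; rewrite (linear_rowE (frame_vec S i u e c) (Bl _)).
by rewrite scaler_sumr; apply: eq_bigr => b _; rewrite scalerA.
Qed.

Lemma sum_frame (A : nmodType) (B : E -> A) :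
  \sum_c B (frame_vec S i u e c)
  = B x + (\sum_k B (e k) + \sum_k B (e k *m P)).
Proof. by rewrite big_option big_sumType. Qed.

End AdaptedFrame.

(** * Connections and the second fundamental form *)

(** The pattern shared by the linearity proofs for [covd_end] and [second_fundamental_form]. *)
Lemma addr_sub_linear (K : pzRingType) (V : lmodType K) (a : K) (x y z x' y' z' : V) :
  (a *: x + x') + (a *: y + y') - (a *: z + z')
  = a *: (x + y - z) + (x' + y' - z').
Proof. by rewrite scalerBr scalerDr [X in X - _]addrACA opprD [LHS]addrACA. Qed.

Section LinearFunction.
Context {K : pzRingType} {V W : lmodType K} (f : V -> W).
Hypothesis fl : linear f.

(** Here [linear] is a property of a bare function, since bilinear expressions such as [christoffel]
    are shown linear one slot at a time. *)
Lemma linear_fun0 : f 0 = 0.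
Proof. by have := zmod_morphism_linear fl 0 0; rewrite !subrr. Qed.

Lemma linear_funD x y : f (x + y) = f x + f y.
Proof. by rewrite -[x]scale1r fl !scale1r. Qed.

Lemma linear_funZ a x : f (a *: x) = a *: f x.
Proof. by rewrite -[a *: x]addr0 fl linear_fun0 addr0. Qed.

Lemma linear_funN x : f (- x) = - f x.
Proof. by rewrite -scaleN1r linear_funZ scaleN1r. Qed.

Lemma linear_fun_sum (I : Type) (r : seq I) (F : I -> V) :
  f (\sum_(k <- r) F k) = \sum_(k <- r) f (F k).
Proof. exact: (big_morph f linear_funD linear_fun0). Qed.

End LinearFunction.

Lemma near_posdef_sym (R : realType) (d : nat) (g : 'rV[R]_d -> 'M[R]_d) (u : 'rV[R]_d) :
  (\forall v \near u, posdef (g v)) -> \forall v \near u, (g v)^T = g v.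
Proof. by apply: filterS => v []. Qed.

Section Connection.
Context {R : realType} {d : nat}.
Local Notation E := 'rV[R]_d.
Variables (g : E -> 'M[R]_d) (u : E).
Implicit Types X Y Z : E.

Lemma christoffelE X Y : christoffel g u X Y =
  2^-1 *: (\row_c (inner (frechet g u X) Y (basis_vec c)
                   + inner (frechet g u Y) X (basis_vec c)
                   - inner (frechet g u (basis_vec c)) X Y)) *m invmx (g u).
Proof. by rewrite frechet.unlock. Qed.

Lemma christoffel_linearl Y : linear (christoffel g u ^~ Y).
Proof.
move=> a X Z /=; rewrite !christoffelE scalemxAl -mulmxDl; congr (_ *m _).
rewrite scalerA mulrC -scalerA -scalerDr; congr (_ *: _); apply/rowP => c.
rewrite !mxE frechetP !(innerDm, innerZm, innerDl, innerZl).
by ring.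
Qed.

Lemma christoffel_linearr X : linear (christoffel g u X).
Proof.
move=> a Y Z /=; rewrite !christoffelE scalemxAl -mulmxDl; congr (_ *m _).
rewrite scalerA mulrC -scalerA -scalerDr; congr (_ *: _); apply/rowP => c.
rewrite !mxE frechetP !(innerDm, innerZm, innerDl, innerZl, innerDr, innerZr).
by ring.
Qed.

Lemma frechet_metric : differentiable g u -> (\forall v \near u, posdef (g v)) ->
  forall X Y Z, inner (frechet g u Z) X Y =
  inner (g u) (christoffel g u Z X) Y + inner (g u) X (christoffel g u Z Y).
Proof.
move=> dg gpos X Y Z; rewrite frechetE; apply: christoffel_metric => //.
  exact: nbhs_singleton gpos.
exact: near_posdef_sym.
Qed.

Lemma covdE (V : E -> E) X : covd g V u X = frechet V u X + christoffel g u X (V u).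
Proof. by rewrite frechetE. Qed.

Lemma covd_cst X Y : covd g (cst Y) u X = christoffel g u X Y.
Proof. by rewrite covdE frechet_cst add0r. Qed.

Lemma covd_linear (V : E -> E) : linear (covd g V u).
Proof.
by move=> a X Y; rewrite !covdE frechetP christoffel_linearl scalerDr addrACA.
Qed.

Variable F : E -> 'M[R]_d.
Hypothesis dF : differentiable F u.

Lemma covd_endE X Y : covd_end g F u X Y =
  Y *m frechet F u X + christoffel g u X (Y *m F u) - christoffel g u X Y *m F u.
Proof. by rewrite /covd_end covd_cst covdE frechet_mulmxl. Qed.

Lemma covd_end_linearl Y : linear (covd_end g F u ^~ Y).
Proof.
move=> a X Z; rewrite !covd_endE frechetP !christoffel_linearl.
rewrite mulmxDr mulmxDl -scalemxAl -scalemxAr.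
exact: addr_sub_linear.
Qed.

Lemma covd_end_linearr X : linear (covd_end g F u X).
Proof.
move=> a Y Z; rewrite !covd_endE !mulmxDl -!scalemxAl !christoffel_linearr.
rewrite mulmxDl -scalemxAl.
exact: addr_sub_linear.
Qed.

End Connection.

(** * The second fundamental form of a map *)

Section SecondFundamentalForm.
Context {R : realType} {d e : nat}.
Variables (g : 'rV[R]_d -> 'M[R]_d) (h : 'rV[R]_e -> 'M[R]_e).
Variables (F : 'rV[R]_d -> 'rV[R]_e) (u : 'rV[R]_d).
Hypothesis dF : twice_diff F u.
Local Notation B := (second_fundamental_form g h F u).
Implicit Types X Y Z : 'rV[R]_d.

Lemma second_fundamental_formE X Y : B X Y =
  frechet (fun v => frechet F v Y) u X
  + christoffel h (F u) (frechet F u X) (frechet F u Y)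
  - frechet F u (christoffel g u X Y).
Proof. by rewrite /second_fundamental_form covd_cst frechet.unlock. Qed.

Lemma second_fundamental_form_linearl Y : linear (B ^~ Y).
Proof.
move=> a X Z; rewrite !second_fundamental_formE !frechetP !christoffel_linearl.
by rewrite frechetP; exact: addr_sub_linear.
Qed.

Lemma second_fundamental_form_linearr X : linear (B X).
Proof.
move=> a Y Z; rewrite !second_fundamental_formE frechetP !christoffel_linearr frechetP.
by rewrite !(frechet_jacobian dF) mulmxDl -scalemxAl; exact: addr_sub_linear.
Qed.

Hypothesis dg : differentiable g u.
Hypothesis gpos : \forall v \near u, posdef (g v).
Hypothesis dh : differentiable h (F u).
Hypothesis hpos : \forall v \near F u, posdef (h v).

(** Second derivatives commute and both connections are torsion-free. *)
Lemma second_fundamental_formC X Y : B X Y = B Y X.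
Proof.
rewrite !second_fundamental_formE (diff2_mxC _ _ dF).
rewrite (christoffelC dg (nbhs_singleton gpos) (near_posdef_sym gpos) X).
by rewrite (christoffelC dh (nbhs_singleton hpos) (near_posdef_sym hpos)).
Qed.

(* Differentiating the commutation relation [df P = s Q df]. *)
Lemma second_fundamental_form_endo (P : 'rV[R]_d -> 'M[R]_d)
    (Q : 'rV[R]_e -> 'M[R]_e) (s : R) X Y :
  differentiable P u -> differentiable Q (F u) ->
  (\forall v \near u, forall Z,
    frechet F v (Z *m P v) = s *: (frechet F v Z *m Q (F v))) ->
  B X (Y *m P u) + frechet F u (covd_end g P u X Y)
  = s *: (B X Y *m Q (F u) + covd_end h Q (F u) (frechet F u X) (frechet F u Y)).
Proof.
move=> dP dQ H; set J := jacobian F.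
have dJ : differentiable J u := differentiable_jacobian dF.
have dF1 := twice_diff_diff dF.
have dQF : differentiable (fun v => Q (F v)) u by exact: differentiable_comp.
have dPJ := differentiable_mulmx dP dJ; have dJQ := differentiable_mulmx dJ dQF.
(* As an identity of matrices the relation covers all [Z] at once; the sign enters as a scalar
   matrix so that the product rule applies throughout. *)
have H' : \forall v \near u, P v *m J v = J v *m Q (F v) *m s%:M.
  apply: filterS H => v Hv; apply/row_matrixP => i; rewrite !rowE mul_mx_scalar -scalemxAr.
  by rewrite !mulmxA !mul_jacobian.
have := near_eq_frechet H' dPJ X; have Hu := nbhs_singleton H'; move: Hu => /=.
rewrite (frechet_mulmxr s%:M X dJQ) (frechet_mulmx X dP dJ) (frechet_mulmx X dJ dQF).
rewrite (frechet_comp X dF1 dQ) !mul_mx_scalar => Hu K.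
rewrite !second_fundamental_formE (covd_endE _ dP) (covd_endE _ dQ).
rewrite !(frechet_jacobian dF) -/J -!mul_jacobian -/J in K *.
move: (frechet J u X) (frechet P u X) (frechet Q _ _) K => DJ DP DQ K.
have L Z : Z *m P u *m J u = s *: (Z *m J u *m Q (F u)).
  by rewrite -mulmxA Hu -scalemxAr mulmxA.
have KY : Y *m P u *m DJ + Y *m DP *m J u = s *: (Y *m DJ *m Q (F u) + Y *m J u *m DQ).
  by rewrite -!mulmxA -!mulmxDr scalemxAr K addrC.
rewrite !L; set c := christoffel g u X Y.
rewrite (linear_funZ (christoffel_linearr _ _ _)) !mulmxBl !mulmxDl -/J L.
(* The connection terms balance: [k] cancels on the left, [g'] on the right, while [gq] and [c1]
   occur with factor [s] on both sides. *)
have alg (a b w1 w2 gq g' k c1 : 'rV[R]_e) : a + b = s *: (w1 + w2) ->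
    a + s *: gq - k + (b + k - s *: c1) = s *: (w1 + g' - c1 + (w2 + gq - g')).
  move=> ab; have -> : b = s *: (w1 + w2) - a by rewrite -ab addrC addKr.
  by apply/rowP => q; rewrite !mxE; ring.
exact: alg.
Qed.

(* Differentiating [h(df Z, C) = l g(Z, A)]. *)
Lemma second_fundamental_form_inner (A : 'rV[R]_d -> 'rV[R]_d)
    (C : 'rV[R]_e -> 'rV[R]_e) (l : 'rV[R]_d -> R) X Y :
  differentiable A u -> differentiable C (F u) -> differentiable l u ->
  (\forall v \near u, forall Z,
    inner (h (F v)) (frechet F v Z) (C (F v)) = l v * inner (g v) Z (A v)) ->
  inner (h (F u)) (B X Y) (C (F u))
  + inner (h (F u)) (frechet F u Y) (covd h C (F u) (frechet F u X))
  = frechet l u X * inner (g u) Y (A u) + l u * inner (g u) Y (covd g A u X).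
Proof.
move=> dA dC dl H.
have dF1 := twice_diff_diff dF.
have dhF : differentiable (fun v => h (F v)) u by exact: differentiable_comp.
have dCF : differentiable (fun v => C (F v)) u by exact: differentiable_comp.
have dY : differentiable (fun _ : 'rV[R]_d => Y) u by exact: differentiable_cst.
have dgA := differentiable_inner dg dY dA.
have H' : \forall v \near u, l v * inner (g v) Y (A v)
    = inner (h (F v)) (frechet F v Y) (C (F v)) by apply: filterS H => v ->.
have := near_eq_frechet H' (differentiableM dl dgA) X.
rewrite (frechet_inner X dhF (dF.2 Y) dCF) (frechetM X dl dgA) (frechet_inner X dg dY dA).
rewrite frechet_cst inner0l addr0 (frechet_comp X dF1 dh) (frechet_comp X dF1 dC).
rewrite (frechet_metric dg gpos) (frechet_metric dh hpos).
rewrite second_fundamental_formE !covdE !(innerDl, innerDr, innerNl).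
(* The relation at [u], for the vector [christoffel g u X Y], converts the last term of the second
   fundamental form. *)
rewrite (nbhs_singleton H) => K.
rewrite !mulrDr in K *; lra.
Qed.

End SecondFundamentalForm.

(** * The divergence of a divergence *)

Lemma sum_antisym (R : numDomainType) (I : finType) (f : I -> I -> R) :
  (forall a c, f a c = - f c a) -> \sum_a \sum_c f a c = 0.
Proof.
move=> fN; apply/eqP; rewrite -eqNr; apply/eqP.
rewrite -sumrN [RHS]exchange_big; apply: eq_bigr => a _.
by rewrite -sumrN; apply: eq_bigr => c _; rewrite [f c a]fN.
Qed.

Section DiffSum.
Context {R : realType} {V : normedModType R}.

Lemma differentiable_bigsum (W : normedModType R) (I : Type) (r : seq I)
    (F : I -> V -> W) x :
  (forall k, differentiable (F k) x) ->
  differentiable (fun v => \sum_(k <- r) F k v) x.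
Proof.
move=> dF; elim: r => [|k r IH].
  by under eq_fun do rewrite big_nil; exact: differentiable_cst.
by under eq_fun do rewrite big_cons; exact: differentiableD.
Qed.

Lemma frechet_sum (W : normedModType R) (I : Type) (r : seq I)
    (F : I -> V -> W) x X :
  (forall k, differentiable (F k) x) ->
  frechet (fun v => \sum_(k <- r) F k v) x X = \sum_(k <- r) frechet (F k) x X.
Proof.
move=> dF; elim: r => [|k r IH].
  by under eq_fun do rewrite big_nil; rewrite frechet_cst big_nil.
under eq_fun do rewrite big_cons.
by rewrite frechetD ?IH ?big_cons//; exact: differentiable_bigsum.
Qed.

Lemma frechetN (W : normedModType R) (f : V -> W) x X : differentiable f x ->
  frechet (fun v => - f v) x X = - frechet f x X.
Proof. by move=> df; rewrite !frechetE -[LHS]/('d (- f) x X) (diffN df). Qed.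

Lemma frechet_skew n (B : V -> 'M[R]_n) x : differentiable B x ->
  (\forall z \near x, forall a c, B z a c = - B z c a) ->
  forall X a c, frechet B x X a c = - frechet B x X c a.
Proof.
move=> dB skewB X a c; rewrite !frechet_entry//.
rewrite -frechetN; last exact: differentiable_entry.
apply/esym/near_eq_frechet; last exact: differentiable_entry.
by apply: filterS skewB => z ->; rewrite ?opprK.
Qed.

Lemma differentiable_mxtrace n (A : V -> 'M[R]_n) x :
  differentiable A x -> differentiable (fun v => \tr (A v)) x.
Proof.
by move=> dA; apply: differentiable_bigsum => k; exact: differentiable_entry.
Qed.

Lemma frechet_mxtrace n (A : V -> 'M[R]_n) x X :
  differentiable A x -> frechet (fun v => \tr (A v)) x X = \tr (frechet A x X).
Proof.
move=> dA; rewrite /mxtrace frechet_sum; last first.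
  by move=> k; exact: differentiable_entry.
by apply: eq_bigr => k _; rewrite frechet_entry.
Qed.

End DiffSum.

Section Divergence.
Context {R : realType} {d : nat}.
Local Notation E := 'rV[R]_d.
Variable g : E -> 'M[R]_d.
Implicit Types u v X : E.

Lemma basis_vecM n a (A : 'M[R]_(d, n)) : basis_vec a *m A = row a A.
Proof. by rewrite rowE. Qed.

Lemma inner_basis_basis (G : 'M[R]_d) a b : inner G (basis_vec a) (basis_vec b) = G a b.
Proof. by rewrite inner_basis basis_vecM mxE. Qed.

(* [log_volume v X] is the derivative of log (sqrt (det g)) along X. *)
Definition log_volume v X : R := 2^-1 * \tr (invmx (g v) *m frechet g v X).

Lemma log_volume_linear v : linear (log_volume v).
Proof.
move=> a X Y; rewrite /log_volume frechetP mulmxDr -scalemxAr mxtraceD mxtraceZ.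
by rewrite mulrDr mulrCA.
Qed.

Section AtPoint.
Variable v : E.
Hypotheses (dg : differentiable g v) (gpos : \forall z \near v, posdef (g z)).
Local Notation A := (invmx (g v)).
Local Notation D a := (frechet g v (basis_vec a)).

Lemma frechet_metric_sym X : (frechet g v X)^T = frechet g v X.
Proof.
rewrite -frechet_trmx//; apply/esym/near_eq_frechet; first exact: near_posdef_sym.
exact: differentiable_trmx.
Qed.

Lemma frechet_metricC X a b : frechet g v X a b = frechet g v X b a.
Proof. by rewrite -[in LHS]frechet_metric_sym mxE. Qed.

Lemma invmx_metricC a b : A a b = A b a.
Proof.
have [gT _] := nbhs_singleton gpos.
by rewrite -[in LHS]gT -trmx_inv mxE.
Qed.

(** The classical formula Gamma^c_(ca) = d_a log sqrt(det g). Two of the three Koszul terms combine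
    to an expression antisymmetric in [c] and [q], which vanishes against the symmetric inverse
    metric. *)
Lemma trace_christoffel X :
  \sum_c christoffel g v (basis_vec c) X 0 c = log_volume v X.
Proof.
have -> : \sum_c christoffel g v (basis_vec c) X 0 c =
    \sum_c \sum_q (2^-1 * (frechet g v X c q * A q c)
    + 2^-1 * ((X *m D c) 0 q - (X *m D q) 0 c) * A q c).
  apply: eq_bigr => c _; rewrite christoffelE mxE; apply: eq_bigr => q _.
  rewrite 2!mxE inner_basis_basis.
  have -> : inner (D q) (basis_vec c) X = (X *m D q) 0 c.
    by rewrite (inner_sym _ _ (frechet_metric_sym _)) inner_basis.
  by rewrite inner_basis; ring.
under eq_bigr do rewrite big_split /=.
rewrite big_split /= [X in _ + X]sum_antisym ?addr0.
  rewrite /log_volume mxtrace_mulC /mxtrace mulr_sumr; apply: eq_bigr => c _.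
  by rewrite mxE mulr_sumr.
by move=> a c; rewrite (invmx_metricC a c); ring.
Qed.

(** In indices, g^(ab) Gamma^c_(ab) = - d_a g^(ac) - g^(ac) d_a log sqrt(det g), because
    [A *m D a *m A] is minus the derivative of the inverse metric. *)
Lemma contract_christoffel :
  \sum_a \sum_b A a b *: christoffel g v (basis_vec a) (basis_vec b) =
  \sum_a (row a (A *m D a *m A) - log_volume v (basis_vec a) *: row a A).
Proof.
have gu := posdef_unitmx (nbhs_singleton gpos).
(* Multiplying by the metric lowers the free index and removes the [invmx] in [christoffel]. *)
apply: (can_inj (mulmxK gu)).
rewrite !mulmx_suml; apply/rowP => c; rewrite !summxE.
transitivity (\sum_a (A *m D a) a c - log_volume v (basis_vec c)); last first.
  apply/esym; rewrite (eq_bigr (fun a =>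
      (A *m D a) a c - log_volume v (basis_vec a) * (a == c)%:R)).
    rewrite sumrB; congr (_ - _); rewrite (bigD1 c)//= eqxx mulr1 big1 ?addr0// => a.
    by move=> /negbTE ->; rewrite mulr0.
  move=> a _; rewrite mulmxBl -scalemxAl -!row_mul (mulmxKV gu) mulVmx//.
  by rewrite !mxE.
transitivity (\sum_a \sum_b A a b * (2^-1 * (D a b c + D b a c - D c a b))).
  apply: eq_bigr => a _; rewrite mulmx_suml summxE; apply: eq_bigr => b _.
  rewrite -scalemxAl mxE christoffelE -!scalemxAl mulmxKV// !mxE.
  by rewrite !inner_basis_basis.
transitivity (\sum_a \sum_b 2^-1 * (A a b * D a b c) + \sum_a \sum_b 2^-1 * (A a b * D b a c)
   - 2^-1 * \sum_a \sum_b A a b * D c a b).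
  rewrite mulr_sumr -big_split -sumrB; apply: eq_bigr => a _.
  rewrite mulr_sumr -big_split -sumrB; apply: eq_bigr => b _.
  by rewrite /=; ring.
congr (_ - _); last first.
  congr (_ * _); rewrite /mxtrace; apply: eq_bigr => a _; rewrite mxE.
  by apply: eq_bigr => b _; rewrite (frechet_metricC _ a b).
rewrite [X in _ + X]exchange_big /= -big_split; apply: eq_bigr => a _.
rewrite mxE -big_split; apply: eq_bigr => b _ /=.
by rewrite (invmx_metricC b a); field.
Qed.

Variable P : E -> 'M[R]_d.
Hypothesis dP : differentiable P v.
Hypothesis Pskew : forall X Y, inner (g v) (X *m P v) Y = - inner (g v) X (Y *m P v).

(** Skewness of [P] for the metric makes P g a skew matrix, and A P = A (P g) A with [A]
    symmetric. *)
Lemma invmx_skew a b : (A *m P v) a b = - (A *m P v) b a.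
Proof.
have [gT _] := nbhs_singleton gpos; have gu := posdef_unitmx (nbhs_singleton gpos).
have PgT : (P v *m g v)^T = - (P v *m g v).
  apply/matrixP => i j; have := Pskew (basis_vec j) (basis_vec i).
  by rewrite (inner_sym _ (basis_vec i *m _) gT) !inner_basis !basis_vecM -!row_mul !mxE.
rewrite trmx_mul gT in PgT.
have : (A *m P v)^T = - (A *m P v).
  rewrite trmx_mul trmx_inv gT -[LHS](mulKmx gu) [g v *m _]mulmxA PgT.
  by rewrite mulNmx mulmxN -(mulmxA (P v)) mulmxV// mulmx1.
by move=> /matrixP/(_ b a); rewrite !mxE.
Qed.

(** With psi = g^-1 P this is the formula (det g)^(-1/2) d_a((det g)^(1/2) psi^(ac)) for the
    divergence of a skew tensor: the skew psi annihilates the symmetric [christoffel], and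
    [contract_christoffel] supplies the volume term. *)
Lemma trace_covd_end :
  \sum_a \sum_b A a b *: covd_end g P v (basis_vec a) (basis_vec b) =
  \sum_a (row a (frechet (fun z => invmx (g z) *m P z) v (basis_vec a))
          + log_volume v (basis_vec a) *: row a (A *m P v)).
Proof.
have gu := posdef_unitmx (nbhs_singleton gpos).
have E1 n (B : 'M[R]_(d, n)) a : \sum_b A a b *: row b B = row a (A *m B).
  by rewrite row_mul mulmx_sum_row; apply: eq_bigr => b _; rewrite mxE.
transitivity (\sum_a row a (A *m frechet P v (basis_vec a))
    + \sum_a \sum_b A a b *: christoffel g v (basis_vec a) (row b (P v))
    - (\sum_a \sum_b A a b *: christoffel g v (basis_vec a) (basis_vec b)) *m P v).
  rewrite mulmx_suml -big_split -sumrB; apply: eq_bigr => a _ /=.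
  rewrite -E1 mulmx_suml -big_split -sumrB; apply: eq_bigr => b _ /=.
  by rewrite covd_endE// !basis_vecM scalerBr scalerDr -scalemxAl.
have -> : \sum_a \sum_b A a b *: christoffel g v (basis_vec a) (row b (P v)) = 0.
  apply/rowP => q; rewrite summxE mxE.
  rewrite -[RHS](@sum_antisym R _ (fun a c =>
    (A *m P v) a c * christoffel g v (basis_vec a) (basis_vec c) 0 q)).
    apply: eq_bigr => a _; rewrite summxE.
    transitivity (christoffel g v (basis_vec a) (row a (A *m P v)) 0 q).
      rewrite -E1 (linear_fun_sum (christoffel_linearr _ _ _)) summxE.
      apply: eq_bigr => b _.
      by rewrite (linear_funZ (christoffel_linearr _ _ _)).
    rewrite (linear_rowE _ (christoffel_linearr _ _ _)) summxE.
    by apply: eq_bigr => b _; rewrite !mxE.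
  move=> a c; rewrite invmx_skew mulNr; congr (- (_ * _)).
  by rewrite (christoffelC dg (nbhs_singleton gpos) (near_posdef_sym gpos)).
rewrite addr0 contract_christoffel mulmx_suml -sumrB; apply: eq_bigr => a _.
rewrite frechet_mulmx//; last exact: differentiable_invmx.
rewrite frechet_invmx// mulmxBl -scalemxAl -!row_mul mulNmx.
by rewrite (raddfD (row a)) (raddfN (row a)) /= opprB addrA [- _ + _]addrC [RHS]addrAC.
Qed.

End AtPoint.

Variable P : E -> 'M[R]_d.
Variable u : E.
Hypotheses (tg : twice_diff g u) (gpos : \forall z \near u, posdef (g z)).
Hypotheses (tP : twice_diff P u).
Hypothesis Pskew : \forall z \near u, forall X Y,
  inner (g z) (X *m P z) Y = - inner (g z) X (Y *m P z).

Let A : E -> 'M[R]_d := fun z => invmx (g z).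

Let tA : twice_diff A u.
Proof. exact: twice_diff_invmx tg (posdef_unitmx (nbhs_singleton gpos)). Qed.

Lemma differentiable_log_volume X : differentiable (fun z => log_volume z X) u.
Proof.
apply: differentiableM; first exact: differentiable_cst.
apply: differentiable_mxtrace; apply: differentiable_mulmx => //.
  exact: twice_diff_diff tA.
exact: tg.2.
Qed.

(** The 1-form [log_volume] is closed: second derivatives of [g] commute, and the quadratic term
    from differentiating the inverse is symmetric because a trace is cyclic. *)
Lemma frechet_log_volumeC X Y :
  frechet (fun z => log_volume z X) u Y = frechet (fun z => log_volume z Y) u X.
Proof.
have gu := posdef_unitmx (nbhs_singleton gpos).
have dA := twice_diff_diff tA; have dg := twice_diff_diff tg.
have dT Z : differentiable (fun z => A z *m frechet g z Z) u.
  exact: differentiable_mulmx dA (tg.2 Z).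
have F Z1 Z2 : frechet (fun z => log_volume z Z1) u Z2
    = 2^-1 * \tr (A u *m frechet (fun z => frechet g z Z1) u Z2
                - A u *m frechet g u Z2 *m A u *m frechet g u Z1).
  rewrite frechetM; last exact: differentiable_mxtrace; last exact: differentiable_cst.
  rewrite frechet_cst mul0r add0r (frechet_mxtrace _ (dT _)).
  rewrite (frechet_mulmx _ dA (tg.2 Z1)) (frechet_invmx _ dg gu).
  by rewrite !mulNmx addrC.
rewrite !F !mxtraceD (diff2_mxC _ _ tg) !raddfN /=; congr (_ * (_ - _)).
by rewrite -mulmxA mxtrace_mulC mulmxA.
Qed.

(* With psi = g^-1 P, the field V is W^c = sum_a (d_a psi^(ac) + w_a psi^(ac)),
   w being [log_volume], and its divergence sum_c (d_c W^c + w_c W^c) pairs the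
   skew psi with expressions that are symmetric in a and c. *)
Lemma divergence_trace_covd_end (V : E -> E) : differentiable V u ->
  (\forall z \near u,
    V z = \sum_a \sum_b A z a b *: covd_end g P z (basis_vec a) (basis_vec b)) ->
  \sum_a \sum_b A u a b * inner (g u) (basis_vec a) (covd g V u (basis_vec b)) = 0.
Proof.
move=> dV HV; pose psi z := A z *m P z.
have tpsi : twice_diff psi u := twice_diff_mulmx tA tP.
have gu := posdef_unitmx (nbhs_singleton gpos).
(* The metric and its inverse cancel, leaving the plain trace of the endomorphism nabla V. *)
have -> : \sum_a \sum_b A u a b * inner (g u) (basis_vec a) (covd g V u (basis_vec b))
    = \sum_c covd g V u (basis_vec c) 0 c.
  rewrite exchange_big; apply: eq_bigr => c _.
  set Z := covd _ _ _ _.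
  transitivity ((Z *m g u *m A u) 0 c); last by rewrite mulmxK.
  rewrite mxE; apply: eq_bigr => a _; rewrite mulrC; congr (_ * _).
  by rewrite (inner_sym _ _ (nbhs_singleton (near_posdef_sym gpos))) inner_basis.
(* [trace_covd_end] is applied at all [z] near [u], and there it asks for positivity on a
   neighbourhood of [z]. *)
have ngpos : \forall z \near u, \forall y \near z, posdef (g y) := near_join gpos.
have dL := differentiable_log_volume.
have Vc c : \forall z \near u, \sum_a (frechet psi z (basis_vec a) a c
      + log_volume z (basis_vec a) * psi z a c) = V z 0 c.
  near=> z; rewrite (near HV z)// (@trace_covd_end z _ _ P).
  - by rewrite summxE; apply: eq_bigr => a _; rewrite !mxE.
  - by near: z; exact: tg.1.
  - by near: z; exact: ngpos.
  - by near: z; exact: tP.1.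
  - by near: z; exact: Pskew.
have dVc c a : differentiable (fun z => frechet psi z (basis_vec a) a c
      + log_volume z (basis_vec a) * psi z a c) u.
  apply: differentiableD; first exact: differentiable_entry (tpsi.2 _).
  by apply: differentiableM => //; exact: differentiable_entry (twice_diff_diff tpsi).
pose T a c := frechet (fun z => frechet psi z (basis_vec a)) u (basis_vec c) a c.
have FV c : frechet V u (basis_vec c) 0 c =
    \sum_a (T a c
      + (frechet (fun z => log_volume z (basis_vec a)) u (basis_vec c) * psi u a c
        + log_volume u (basis_vec a) * frechet psi u (basis_vec c) a c)).
  rewrite (frechet_entry _ _ _ dV) (near_eq_frechet (Vc c)); last first.
    exact: differentiable_bigsum.
  rewrite frechet_sum//; apply: eq_bigr => a _.
  have d1 := differentiable_entry a c (tpsi.2 (basis_vec a)).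
  have d2 := differentiable_entry a c (twice_diff_diff tpsi).
  rewrite frechetD//; last exact: differentiableM.
  rewrite frechetM// /T (frechet_entry _ _ _ (tpsi.2 _)).
  by rewrite (frechet_entry _ _ _ (twice_diff_diff tpsi)).
have psiN : \forall z \near u, forall a c, psi z a c = - psi z c a.
  near=> z; apply: invmx_skew.
  - by near: z; exact: ngpos.
  - by near: z; exact: Pskew.
have npsiN : \forall z \near u, \forall y \near z, forall a c, psi y a c = - psi y c a.
  exact: near_join psiN.
have dpsiN : \forall z \near u, forall X a c,
    frechet psi z X a c = - frechet psi z X c a.
  near=> z; apply: frechet_skew; first by near: z; exact: tpsi.1.
  by near: z; exact: npsiN.
(* Exchanging the two derivatives turns [T a c] into the entry of [T c a] with transposed matrix
   indices; skewness of psi gives the sign. *)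
have TN a c : T a c = - T c a.
  rewrite /T (diff2_mxC _ _ tpsi); apply: (frechet_skew (tpsi.2 _)).
  by apply: filterS dpsiN => z; exact.
pose w a := log_volume u (basis_vec a).
(* The two terms with one [w] and one derivative of psi exchange, up to sign, when [a] and [c] do;
   each other term is antisymmetric by itself. *)
rewrite -[RHS](@sum_antisym R _ (fun c a => T a c
  + (frechet (fun z => log_volume z (basis_vec a)) u (basis_vec c) * psi u a c
    + w a * frechet psi u (basis_vec c) a c)
  + (frechet psi u (basis_vec a) a c + w a * psi u a c) * w c)).
  rewrite (eq_bigr (fun c => frechet V u (basis_vec c) 0 c
      + christoffel g u (basis_vec c) (V u) 0 c)); last by move=> c _; rewrite covdE mxE.
  rewrite big_split /= (trace_christoffel (twice_diff_diff tg) gpos).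
  rewrite (linear_rowE _ (log_volume_linear _)) -big_split; apply: eq_bigr => c _ /=.
  rewrite FV -(nbhs_singleton (Vc c)) /GRing.scale /= mulr_suml -big_split.
  by apply: eq_bigr => a _.
move=> a c; rewrite TN (nbhs_singleton psiN c a).
rewrite (nbhs_singleton dpsiN _ c a) (frechet_log_volumeC _ (basis_vec a)).
rewrite (nbhs_singleton dpsiN (basis_vec c) a c); ring.
Unshelve. all: by end_near. Qed.

End Divergence.

(** * Derivatives of the structure fields inside a chart *)

Section ChartTheory.
Context {R : realType} {d : nat} {M : manifold R d}.

Lemma near_chart_image (i : atlas M) u :
  chart_image i u -> \forall v \near u, chart_image i v.
Proof. by move=> Hu; apply: open_nbhs_nbhs; split=> //; exact: chart_open. Qed.

Lemma smooth_field_twice_diff (W : normedModType R) (T : atlas M -> 'rV[R]_d -> W) i u :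
  smooth_field T -> chart_image i u -> twice_diff (T i) u.
Proof. by move=> sT; apply: smooth_on_twice_diff (sT i); exact: chart_open. Qed.

End ChartTheory.

Section ContactDerivatives.
Context {R : realType} {m : nat} {M : manifold R m.*2.+1}.
Variables (S : almost_contact_metric M) (i : atlas M) (u : 'rV[R]_(m.*2.+1)).
Hypothesis Hu : chart_image i u.
Local Notation E := 'rV[R]_(m.*2.+1).
Local Notation G := (metric S i u).
Local Notation P := (phi S i u).
Local Notation x := (xi S i u).
Local Notation w := (eta S i u).
Implicit Types X Y : E.

Lemma metric_twice_diff : twice_diff (metric S i) u.
Proof. by apply: smooth_field_twice_diff => //; case: (metric_field S). Qed.

Lemma phi_twice_diff : twice_diff (phi S i) u.
Proof. by apply: smooth_field_twice_diff => //; case: (phi_field S). Qed.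

Lemma xi_twice_diff : twice_diff (xi S i) u.
Proof. by apply: smooth_field_twice_diff => //; case: (xi_field S). Qed.

Lemma near_metric_posdef : \forall v \near u, posdef (metric S i v).
Proof. by apply: filterS (near_chart_image Hu) => v; exact: metric_posdef. Qed.

Lemma nabla_phi_linearl Y : linear (nabla_phi S i u ^~ Y).
Proof. exact: covd_end_linearl (twice_diff_diff phi_twice_diff) _. Qed.

Lemma nabla_phi_linearr X : linear (nabla_phi S i u X).
Proof. exact: covd_end_linearr (twice_diff_diff phi_twice_diff) _. Qed.

Lemma nabla_xi_linear : linear (nabla_xi S i u).
Proof. exact: covd_linear. Qed.

(** Differentiate phi xi = 0 along [X]. *)
Lemma nabla_phi_xi X : nabla_phi S i u X x = - (nabla_xi S i u X *m P).
Proof.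
have dx := twice_diff_diff xi_twice_diff; have dP := twice_diff_diff phi_twice_diff.
have : frechet (fun v => xi S i v *m phi S i v) u X = 0.
  rewrite (@near_eq_frechet _ _ _ (cst 0)) ?frechet_cst//.
  by apply: filterS (near_chart_image Hu) => v Hv; rewrite xi_phi.
rewrite frechet_mulmx// => /eqP; rewrite addrC addr_eq0 => /eqP E0.
rewrite /nabla_phi covd_endE// xi_phi// (linear_fun0 (christoffel_linearr _ _ _)) addr0.
by rewrite E0 /nabla_xi covdE mulmxDl opprD.
Qed.

(** Differentiate g(xi, xi) = 1, using that the connection is metric. *)
Lemma inner_nabla_xi X : inner G (nabla_xi S i u X) x = 0.
Proof.
have dx := twice_diff_diff xi_twice_diff; have dG := twice_diff_diff metric_twice_diff.
have : frechet (fun v => inner (metric S i v) (xi S i v) (xi S i v)) u X = 0.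
  rewrite (@near_eq_frechet _ _ R (cst 1)) ?frechet_cst//.
  by apply: filterS (near_chart_image Hu) => v Hv; rewrite inner_xi_xi.
rewrite frechet_inner// (frechet_metric dG near_metric_posdef).
rewrite /nabla_xi covdE innerDl !(innerC S Hu x).
by move: (inner _ _ _) => a b; lra.
Qed.

Lemma pairing_nabla_xi X : pairing w (nabla_xi S i u X) = 0.
Proof. by rewrite -inner_xi// inner_nabla_xi. Qed.

Variable e : 'I_m -> E.
Hypothesis He : adapted_frame S i u e.

Lemma frame_eta k : pairing w (e k) = 0.
Proof. by have := He (Some (inl k)) None; rewrite /= inner_xi. Qed.

Lemma inner_frame_xi c : inner G (frame_vec S i u e c) x = (c == None)%:R.
Proof. by have := He c None. Qed.

(** The right-hand side is the vector inside [delta_Omega], so the semi-Sasakian condition concerns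
    a full metric trace, independent of the frame. *)
Lemma trace_nabla_phi :
  \sum_c nabla_phi S i u (frame_vec S i u e c) (frame_vec S i u e c) =
  - (nabla_xi S i u x *m P) + \sum_k P_tensor S i u (e k) (e k).
Proof. by rewrite (sum_frame _ _ _ _ (fun X => nabla_phi S i u X X)) nabla_phi_xi -big_split. Qed.

End ContactDerivatives.

(** * Consequences of the semi-Sasakian condition *)

Section SemiSasakian.
Context {R : realType} {m : nat} {M : manifold R m.*2.+1}.
Variable S : almost_contact_metric M.
Hypothesis HS : almost_semi_Sasakian S.

Lemma semi_Sasakian_trace i u e : chart_image i u -> adapted_frame S i u e ->
  \sum_c nabla_phi S i u (frame_vec S i u e c) (frame_vec S i u e c) =
  m.*2%:R *: xi S i u.
Proof.
move=> Hu He; apply: (inner_inj (metric_posdef S Hu)) => X.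
rewrite trace_nabla_phi// [LHS](HS Hu He) innerZl; congr (_ * _).
by rewrite innerC// inner_xi.
Qed.

(* [xi] is a multiple of the divergence of the skew tensor [phi], and the
   divergence of such a divergence vanishes. *)
Lemma divergence_xi i u e : chart_image i u -> adapted_frame S i u e ->
  \sum_c inner (metric S i u) (frame_vec S i u e c)
           (nabla_xi S i u (frame_vec S i u e c)) = 0.
Proof.
move=> Hu He; have [m0|m0] := posnP m.
  (* For [m = 0] the frame consists of xi alone. *)
  rewrite (sum_frame _ _ _ _ (fun X => inner _ X (nabla_xi S i u X))).
  rewrite innerC// inner_nabla_xi// !big1 ?addr0// => k.
    by have := ltn_ord k; rewrite [X in (_ < X)%N]m0.
  by have := ltn_ord k; rewrite [X in (_ < X)%N]m0.
have dxi := twice_diff_diff (xi_twice_diff S Hu).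
pose V v := xi S i v *m (m.*2%:R)%:M.
have dV : differentiable V u by apply: differentiable_mulmx => //; exact: differentiable_cst.
have H : \sum_a \sum_b invmx (metric S i u) a b
    * inner (metric S i u) (basis_vec a) (covd (metric S i) V u (basis_vec b)) = 0.
  apply: (divergence_trace_covd_end (P := phi S i)) => //.
  - exact: metric_twice_diff.
  - exact: near_metric_posdef.
  - exact: phi_twice_diff.
  - by apply: filterS (near_chart_image Hu) => v Hv X Y; exact: inner_phi.
  apply: filterS (near_chart_image Hu) => v Hv.
  (* A frame is chosen separately at each [v], without any continuity: only the coordinate trace
     gets differentiated. *)
  have [ev Hev] := adapted_frame_exists S Hv.
  rewrite /V mul_mx_scalar -(semi_Sasakian_trace Hv Hev) -trace_frame//.
  - by move=> X; exact: nabla_phi_linearr.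
  - by move=> X; exact: nabla_phi_linearl.
have E X : covd (metric S i) V u X = m.*2%:R *: nabla_xi S i u X.
  rewrite /nabla_xi !covdE /V frechet_mulmxr// !mul_mx_scalar scalerDr.
  by rewrite (linear_funZ (christoffel_linearr _ _ _)).
have : m.*2%:R * \sum_c inner (metric S i u) (frame_vec S i u e c)
           (nabla_xi S i u (frame_vec S i u e c)) = 0.
  rewrite -(trace_frame Hu He (B := fun X Y => inner (metric S i u) X (nabla_xi S i u Y))).
  - rewrite mulr_sumr -[RHS]H; apply: eq_bigr => a _; rewrite mulr_sumr.
    by apply: eq_bigr => b _; rewrite E innerZr /GRing.scale /= mulrCA.
  - by move=> X a Y Z; rewrite nabla_xi_linear innerDr innerZr.
  - by move=> X a Y Z; rewrite innerDl innerZl.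
by move=> /eqP; rewrite mulf_eq0 pnatr_eq0 double_eq0 (gtn_eqF m0) => /eqP.
Qed.

End SemiSasakian.

(** * Local representatives of a smooth map *)

Section LocalRep.
Context {R : realType} {d e : nat} {M : manifold R d} {N : manifold R e}.
Variable f : M -> N.
Hypothesis fs : smooth_map f.

Lemma local_repE i j p : chart_dom i p -> local_rep f i j (chart i p) = chart j (f p).
Proof. by move=> Hi; rewrite /local_rep /= chartK. Qed.

Lemma open_local_dom (i : atlas M) (j : atlas N) :
  open (chart i @` (chart_dom i `&` f @^-1` chart_dom j)).
Proof.
rewrite openE => u [p [Hi Hj] <-].
have Hu : chart_image i (chart i p) by exists p.
have nparam : \forall v \near chart i p, chart_dom j (f (param i v)).
  have nf : nbhs p (f @^-1` chart_dom j).
    by apply: (fs.1 p); apply: open_nbhs_nbhs; split => //; exact: chart_dom_open.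
  have pc := param_continuous Hu; rewrite /prop_for /continuous_at (chartK Hi) in pc.
  exact: pc nf.
apply: filterS2 (near_chart_image Hu) nparam => v [q Hq <-].
by rewrite chartK// => Hfq; exists q.
Qed.

(** Relations for the tangent map are stated at points of [M]; this makes them hold near a chart
    point, where they can be differentiated. *)
Lemma near_local_dom i j p : chart_dom i p -> chart_dom j (f p) ->
  \forall v \near chart i p,
    exists q, [/\ chart_dom i q, chart_dom j (f q) & v = chart i q].
Proof.
move=> Hi Hj.
have : \forall v \near chart i p, (chart i @` (chart_dom i `&` f @^-1` chart_dom j)) v.
  by apply: open_nbhs_nbhs; split; [exact: open_local_dom|exists p].
by apply: filterS => v [q [Hq Hfq] <-]; exists q.
Qed.

Lemma local_rep_twice_diff i j p : chart_dom i p -> chart_dom j (f p) ->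
  twice_diff (local_rep f i j) (chart i p).
Proof.
move=> Hi Hj; apply: smooth_on_twice_diff (fs.2 i j) _; first exact: open_local_dom.
by exists p.
Qed.

End LocalRep.

(** * The derivative of xi in the two target classes *)

Section SpecialClasses.
Context {R : realType} {m : nat} {M : manifold R m.*2.+1}.
Variables (S : almost_contact_metric M) (i : atlas M) (u : 'rV[R]_(m.*2.+1)).
Hypothesis Hu : chart_image i u.
Local Notation G := (metric S i u).
Local Notation P := (phi S i u).
Local Notation x := (xi S i u).
Implicit Types X Y : 'rV[R]_(m.*2.+1).

Lemma quasi_K_nabla_phi_xi : quasi_K_cosymplectic S ->
  forall X, nabla_phi S i u X x = nabla_xi S i u (X *m P).
Proof.
move=> qK X; have := qK _ _ Hu X x.
rewrite /P_tensor xi_phi// (linear_fun0 (nabla_phi_linearr S Hu _)) addr0.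
by rewrite eta_xi// scale1r.
Qed.

(** In this class nabla_(phi X) xi = - phi(nabla_X xi), and phi preserves the product because
    nabla_X xi is orthogonal to xi. Hence X and phi X cancel in traces. *)
Lemma quasi_K_inner_nabla_xi : quasi_K_cosymplectic S -> forall X,
  inner G (X *m P) (nabla_xi S i u (X *m P)) = - inner G X (nabla_xi S i u X).
Proof.
move=> qK X; rewrite -quasi_K_nabla_phi_xi// nabla_phi_xi// innerNr metric_phi//.
by rewrite pairing_nabla_xi// mulr0 subr0.
Qed.

(** Apply phi to the defining identity at Y = xi; phi^2 acts as -1 on nabla_X xi, which has no
    xi-component. *)
Lemma alpha_Sasakian_nabla_xi (alpha : R) : alpha_Sasakian S alpha ->
  forall X, nabla_xi S i u X = - alpha *: (X *m P).
Proof.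
move=> [_ aS] X; have := aS _ _ Hu X x; rewrite nabla_phi_xi// inner_xi// eta_xi// scale1r.
move=> /(congr1 (fun Y => Y *m P)); rewrite mulNmx phi_phi// pairing_nabla_xi// scale0r addr0 opprK.
by rewrite -scalemxAl mulmxBl -scalemxAl xi_phi// scaler0 sub0r scalerN scaleNr.
Qed.

Lemma alpha_Sasakian_inner_nabla_xi (alpha : R) : alpha_Sasakian S alpha ->
  forall X, inner G X (nabla_xi S i u X) = 0.
Proof.
by move=> aS X; rewrite (alpha_Sasakian_nabla_xi aS) innerZr inner_phi_diag// mulr0.
Qed.

End SpecialClasses.

(** * Tension of holomorphic maps *)

Section ContactMap.
Context {R : realType} {m n : nat} {M : manifold R m.*2.+1} {N : manifold R n.*2.+1}.
Variables (S : almost_contact_metric M) (T : almost_contact_metric N) (f : M -> N).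
Hypothesis fs : smooth_map f.
Variable s : R.
Hypothesis ss : s * s = 1.
Hypothesis hol : signed_holomorphic S T f s.

Section AtPoint.
Variables (i : atlas M) (j : atlas N) (p : M).
Hypotheses (Hi : chart_dom i p) (Hj : chart_dom j (f p)).
Local Notation E := 'rV[R]_(m.*2.+1).
Local Notation u := (chart i p).
Local Notation y := (chart j (f p)).
Local Notation F := (local_rep f i j).
Local Notation df := (frechet F u).
Local Notation P := (phi S i u).
Local Notation Q := (phi T j y).
Local Notation x := (xi S i u).
Local Notation c := (xi T j y).
Local Notation w := (eta S i u).
Local Notation t := (eta T j y).
Implicit Types X Y Z : E.

Let Hu : chart_image i u. Proof. by exists p. Qed.
Let Hy : chart_image j y. Proof. by exists (f p). Qed.

Lemma df_phi X : df (X *m P) = s *: (df X *m Q).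
Proof. by rewrite !frechetE; exact: hol. Qed.

(** Holomorphy and phi xi = 0 place df(xi) in the kernel of phi', which is spanned by gamma. *)
Lemma df_xi : df x = pairing t (df x) *: c.
Proof.
apply: phi_eq0 => //; rewrite -[LHS]scale1r -ss -scalerA -df_phi xi_phi//.
by rewrite (linear_fun0 (frechetP _ _)) scaler0.
Qed.

Lemma eta_df_phi X : pairing t (df (X *m P)) = 0.
Proof. by rewrite df_phi pairingZ eta_phi// mulr0. Qed.

(** Split X as eta(X) xi - phi^2 X; by holomorphy sigma vanishes on the image of phi under df. *)
Lemma eta_df X : pairing t (df X) = pairing t (df x) * pairing w X.
Proof.
have E0 : X = pairing w X *: x - X *m P *m P by rewrite phi_phi// opprD opprK addrCA subrr addr0.
rewrite {1}E0 (linear_funD (frechetP _ _)) (linear_funN (frechetP _ _)).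
rewrite (linear_funZ (frechetP _ _)) pairingD pairingN pairingZ eta_df_phi subr0.
exact: mulrC.
Qed.

End AtPoint.

Section Tension.
Variables (i : atlas M) (j : atlas N) (p : M).
Hypotheses (Hi : chart_dom i p) (Hj : chart_dom j (f p)).
Local Notation E := 'rV[R]_(m.*2.+1).
Local Notation u := (chart i p).
Local Notation y := (chart j (f p)).
Local Notation F := (local_rep f i j).
Local Notation df := (frechet F u).
Local Notation G := (metric S i u).
Local Notation H := (metric T j y).
Local Notation P := (phi S i u).
Local Notation Q := (phi T j y).
Local Notation x := (xi S i u).
Local Notation c := (xi T j y).
Local Notation w := (eta S i u).
Local Notation t := (eta T j y).
Local Notation B := (second_fundamental_form (metric S i) (metric T j) F u).
Local Notation tau := (local_tension (metric S i) (metric T j) F u).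
Implicit Types X Y Z : E.

Let Hu : chart_image i u. Proof. by exists p. Qed.
Let Hy : chart_image j y. Proof. by exists (f p). Qed.
Let Fu : F u = y. Proof. exact: local_repE. Qed.
Let tF : twice_diff F u. Proof. exact: local_rep_twice_diff. Qed.

Let Blinl Y : linear (B ^~ Y).
Proof. exact: second_fundamental_form_linearl. Qed.

Let Blinr X : linear (B X).
Proof. exact: second_fundamental_form_linearr. Qed.

Let dH : differentiable (metric T j) (F u).
Proof. by rewrite Fu; exact: twice_diff_diff (metric_twice_diff T Hy). Qed.

Let posH : \forall v \near F u, posdef (metric T j v).
Proof. by rewrite Fu; exact: near_metric_posdef. Qed.

Let dG : differentiable (metric S i) u.
Proof. exact: twice_diff_diff (metric_twice_diff S Hu). Qed.

Let posG := near_metric_posdef S Hu.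

Lemma nabla_phi_df X Y : B X (Y *m P) + df (nabla_phi S i u X Y)
  = s *: (B X Y *m Q + nabla_phi T j y (df X) (df Y)).
Proof.
have dP := twice_diff_diff (phi_twice_diff S Hu).
have dQ : differentiable (phi T j) (F u).
  by rewrite Fu; exact: twice_diff_diff (phi_twice_diff T Hy).
rewrite -Fu in dQ *; apply: second_fundamental_form_endo => //.
apply: filterS (near_local_dom fs Hi Hj) => v [q [Hq Hfq ->]] Z.
by rewrite !frechetE local_repE//; exact: hol.
Qed.

Variable e : 'I_m -> E.
Hypothesis He : adapted_frame S i u e.

Lemma tension_frame :
  tau = \sum_a B (frame_vec S i u e a) (frame_vec S i u e a).
Proof. by rewrite /local_tension (trace_frame Hu He). Qed.

(* Off [xi] the terms [B(e, phi e)] and [B(phi e, phi (phi e))] cancel. *)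
Lemma tension_phi :
  df (\sum_a nabla_phi S i u (frame_vec S i u e a) (frame_vec S i u e a)) =
  s *: (tau *m Q + nabla_phi T j y (df x) (df x)
        + \sum_k P_tensor T j y (df (e k)) (df (e k))).
Proof.
have Kx : df (nabla_phi S i u x x) = s *: (B x x *m Q + nabla_phi T j y (df x) (df x)).
  by rewrite -nabla_phi_df xi_phi// (linear_fun0 (Blinr _)) add0r.
(* In the equation for phi e, the vector df(phi e) = s phi' df(e) fills both slots of nabla' phi',
   so [ss] leaves exactly the second half of [P_tensor]. *)
have Ke k : df (nabla_phi S i u (e k) (e k)) + df (nabla_phi S i u (e k *m P) (e k *m P))
    = s *: ((B (e k) (e k) + B (e k *m P) (e k *m P)) *m Q + P_tensor T j y (df (e k)) (df (e k))).
  have := nabla_phi_df (e k *m P) (e k *m P); have := nabla_phi_df (e k) (e k).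
  rewrite (phi_phi S Hu) (frame_eta Hu He) scale0r addr0 (linear_funN (Blinr _)).
  rewrite (second_fundamental_formC tF dG posG dH posH (e k *m P)).
  rewrite !(df_phi Hi Hj) (linear_funZ (nabla_phi_linearr T Hy _)).
  rewrite (linear_funZ (nabla_phi_linearl T Hy _)) scalerA ss scale1r.
  move: (B (e k) (e k *m P)) => b E1 E2.
  rewrite /P_tensor mulmxDl addrACA scalerDr -E1 -E2.
  by rewrite addrACA subrr add0r.
rewrite tension_frame (linear_fun_sum (frechetP _ _)).
rewrite (sum_frame _ _ _ _ (fun X => df (nabla_phi S i u X X))).
rewrite (sum_frame _ _ _ _ (fun X => B X X)) -!big_split /=.
transitivity (s *: (B x x *m Q + nabla_phi T j y (df x) (df x))
  + s *: (\sum_k (B (e k) (e k) + B (e k *m P) (e k *m P)) *m Q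
          + \sum_k P_tensor T j y (df (e k)) (df (e k)))).
  congr (_ + _); first exact: Kx.
  by rewrite -big_split scaler_sumr; apply: eq_bigr => k _; exact: Ke.
by rewrite -scalerDr addrACA [in RHS]mulmxDl mulmx_suml addrA.
Qed.

Hypothesis HS : almost_semi_Sasakian S.

Lemma semi_Sasakian_tension : m.*2%:R *: df x =
  s *: (tau *m Q + nabla_phi T j y (df x) (df x)
        + \sum_k P_tensor T j y (df (e k)) (df (e k))).
Proof. by rewrite -tension_phi (semi_Sasakian_trace HS Hu He) (linear_funZ (frechetP _ _)). Qed.

(* Differentiating [t (df Z) = l w Z] and taking the trace. *)
Lemma eta_tension (l : E -> R) : differentiable l u ->
  (\forall v \near u, forall q, chart_dom i q -> chart_dom j (f q) -> v = chart i q ->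
     frechet F v (xi S i v) = l v *: xi T j (chart j (f q))) ->
  pairing t tau + \sum_a inner H (df (frame_vec S i u e a))
      (nabla_xi T j y (df (frame_vec S i u e a))) = frechet l u x.
Proof.
move=> dl Hl.
have dA := twice_diff_diff (xi_twice_diff S Hu).
have dC : differentiable (xi T j) (F u).
  by rewrite Fu; exact: twice_diff_diff (xi_twice_diff T Hy).
have K X : inner H (B X X) c + inner H (df X) (nabla_xi T j y (df X))
    = frechet l u X * inner G X x + l u * inner G X (nabla_xi S i u X).
  rewrite /nabla_xi -Fu.
  apply: (second_fundamental_form_inner tF dG posG dH posH X X dA dC dl).
  apply: filterS2 (near_local_dom fs Hi Hj) Hl => v [q [Hq Hfq vq]] /(_ q Hq Hfq vq).
  rewrite vq => lq Z; have Hv : chart_image i (chart i q) by exists q.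
  have Hfv : chart_image j (chart j (f q)) by exists (f q).
  by rewrite local_repE// !inner_xi// (eta_df Hq Hfq) lq pairingZ eta_xi// mulr1.
(* In the sum of [K] over the frame, [divergence_xi] removes the term with [l u], and in the other
   one only xi pairs with xi. *)
rewrite tension_frame -inner_xi// inner_suml -big_split /= (eq_bigr _ (fun a _ => K _)).
rewrite big_split /= -mulr_sumr (divergence_xi HS Hu He) mulr0 addr0.
rewrite (bigD1 None)//= inner_xi_xi// mulr1 big1 ?addr0// => a a0.
by rewrite (inner_frame_xi He) (negbTE a0) mulr0.
Qed.

Lemma nabla_phi_df_xi : nabla_phi T j y c c = 0 -> nabla_phi T j y (df x) (df x) = 0.
Proof.
move=> cc0; rewrite (df_xi Hi Hj) (linear_funZ (nabla_phi_linearr T Hy _)).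
by rewrite (linear_funZ (nabla_phi_linearl T Hy _)) cc0 !scaler0.
Qed.

(** Applying phi' to [semi_Sasakian_tension] kills df(xi), a multiple of gamma, as well as the
    [P_tensor] sum; phi'^2 tau = 0 remains. *)
Lemma tension_normal : nabla_phi T j y c c = 0 ->
  (forall k, P_tensor T j y (df (e k)) (df (e k)) *m Q = 0) ->
  tau = pairing t tau *: c.
Proof.
move=> cc0 P0; set W := \sum_k P_tensor T j y (df (e k)) (df (e k)).
have W0 : W *m Q = 0 by rewrite mulmx_suml big1.
have tQ : (tau *m Q + W) *m Q = tau *m Q *m Q by rewrite mulmxDl W0 addr0.
have := congr1 (mulmxr Q) semi_Sasakian_tension.
rewrite /= -!scalemxAl (nabla_phi_df_xi cc0) addr0 -/W tQ.
rewrite {1}(df_xi Hi Hj) -scalemxAl xi_phi// !scaler0 => /esym.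
move=> /(congr1 ( *:%R s)); rewrite scalerA ss scale1r scaler0 phi_phi//.
by move=> /eqP; rewrite addrC subr_eq0 => /eqP.
Qed.

Lemma quasi_K_P_tensor_df k : quasi_K_cosymplectic T ->
  P_tensor T j y (df (e k)) (df (e k)) = 0.
Proof.
move=> qK.
by rewrite (qK _ _ Hy) (eta_df Hi Hj) (frame_eta Hu He) mulr0 scale0r.
Qed.

(** Since sigma vanishes on df(e) and on the image of phi', both halves of [P_tensor] are multiples
    of gamma. *)
Lemma alpha_Sasakian_P_tensor_df alpha k : alpha_Sasakian T alpha ->
  P_tensor T j y (df (e k)) (df (e k)) *m Q = 0.
Proof.
move=> [_ aS]; rewrite /P_tensor !(aS _ _ Hy) (eta_df Hi Hj) (frame_eta Hu He) mulr0.
rewrite eta_phi// !scale0r !subr0 mulmxDl -!scalemxAl.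
by rewrite xi_phi// !scaler0 addr0.
Qed.

(** Here [semi_Sasakian_tension] reduces to 2m df(xi) = s phi' tau. The left side is a multiple of
    gamma and the right side has no gamma-component. *)
Lemma quasi_K_df_xi0 : quasi_K_cosymplectic T -> (0 < m)%N -> df x = 0.
Proof.
move=> qK m0; have := semi_Sasakian_tension.
rewrite big1 ?addr0 => [|k _]; last exact: quasi_K_P_tensor_df.
rewrite nabla_phi_df_xi ?addr0; last first.
  by rewrite quasi_K_nabla_phi_xi// xi_phi// (linear_fun0 (nabla_xi_linear _ _ _)).
rewrite (df_xi Hi Hj).
move=> /(congr1 (pairing t)); rewrite !pairingZ eta_phi// eta_xi// mulr0 mulr1.
move=> /eqP; rewrite mulf_eq0 pnatr_eq0 double_eq0 (gtn_eqF m0) => /eqP ->.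
by rewrite scale0r.
Qed.

End Tension.

(** * Harmonicity for the two target classes *)

Hypothesis HS : almost_semi_Sasakian S.

(** For [m = 0] the equation for 2m df(xi) says nothing about df(xi), and harmonicity can fail:
    every smooth function between two lines is holomorphic. *)
Lemma quasi_K_harmonic : quasi_K_cosymplectic T -> (0 < m)%N -> harmonic_map S T f.
Proof.
move=> qK m0 i j p Hi Hj.
have Hu : chart_image i (chart i p) by exists p.
have Hy : chart_image j (chart j (f p)) by exists (f p).
have [e He] := adapted_frame_exists S Hu.
have cc0 : nabla_phi T j (chart j (f p)) (xi T j (chart j (f p))) (xi T j (chart j (f p))) = 0.
  by rewrite quasi_K_nabla_phi_xi// xi_phi// (linear_fun0 (nabla_xi_linear _ _ _)).
rewrite (tension_normal Hi Hj He HS cc0); last first.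
  by move=> k; rewrite (quasi_K_P_tensor_df Hi Hj He)// mul0mx.
(* [quasi_K_df_xi0] holds at every point, so [eta_tension] applies with the zero function as
   lambda. *)
have dl : differentiable (fun _ : 'rV[R]_(m.*2.+1) => 0 : R) (chart i p).
  exact: differentiable_cst.
have := eta_tension Hi Hj He HS dl; rewrite frechet_cst.
have Hl : \forall v \near chart i p, forall q, chart_dom i q -> chart_dom j (f q) ->
    v = chart i q -> frechet (local_rep f i j) v (xi S i v) = 0 *: xi T j (chart j (f q)).
  near=> v => q Hq Hfq ->; rewrite scale0r.
  have Hv : chart_image i (chart i q) by exists q.
  have [e' He'] := adapted_frame_exists S Hv.
  exact: (quasi_K_df_xi0 Hq Hfq He' HS qK m0).
set F := local_rep f i j; set u := chart i p.
have qxi := @quasi_K_inner_nabla_xi _ _ _ T _ _ Hy qK.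
(* xi contributes nothing as df(xi) = 0, and e and phi e contribute opposite amounts by [qxi]. *)
have E0 : \sum_a inner (metric T j (chart j (f p))) (frechet F u (frame_vec S i u e a))
    (nabla_xi T j (chart j (f p)) (frechet F u (frame_vec S i u e a))) = 0.
  rewrite (sum_frame _ _ _ _ (fun X => inner _ (frechet F u X) (nabla_xi _ _ _ (frechet F u X)))).
  rewrite (quasi_K_df_xi0 Hi Hj He HS qK m0) inner0l add0r -big_split big1// => k _ /=.
  rewrite (df_phi Hi Hj) (linear_funZ (nabla_xi_linear _ _ _)) innerZl innerZr mulrA ss mul1r.
  by rewrite qxi subrr.
by move=> /(_ Hl); rewrite E0 addr0 => ->; rewrite scale0r.
Unshelve. all: by end_near. Qed.

(** The tension is normal by [tension_normal], and in [eta_tension] the sum vanishes since nabla'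
    gamma is a multiple of the skew phi'. *)
Lemma alpha_Sasakian_tension alpha l i j p : chart_dom i p -> chart_dom j (f p) ->
  alpha_Sasakian T alpha -> smooth_function l -> tangent_map_xi S T f l ->
  local_tension (metric S i) (metric T j) (local_rep f i j) (chart i p)
  = 'd (l \o param i : 'rV[R]_(m.*2.+1) -> R) (chart i p) (xi S i (chart i p))
    *: xi T j (chart j (f p)).
Proof.
move=> Hi Hj aS ls Hl.
have Hu : chart_image i (chart i p) by exists p.
have Hy : chart_image j (chart j (f p)) by exists (f p).
have [e He] := adapted_frame_exists S Hu.
have cc0 : nabla_phi T j (chart j (f p)) (xi T j (chart j (f p))) (xi T j (chart j (f p))) = 0.
  by rewrite aS.2// inner_xi_xi// eta_xi// subrr scaler0.
rewrite (tension_normal Hi Hj He HS cc0); last first.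
  by move=> k; exact: (alpha_Sasakian_P_tensor_df Hi Hj He k aS).
have dl : differentiable (l \o param i : 'rV[R]_(m.*2.+1) -> R) (chart i p).
  exact: twice_diff_diff (smooth_field_twice_diff ls Hu).
rewrite -frechetE -(eta_tension Hi Hj He HS dl).
  rewrite big1 ?addr0// => a _.
  exact: (alpha_Sasakian_inner_nabla_xi Hy aS).
near=> v => q Hq Hfq ->; rewrite /= chartK// frechetE; exact: Hl.
Unshelve. all: by end_near. Qed.

End ContactMap.

Theorem corollary4p2 (R : realType) (m n : nat)
  (M : manifold R m.*2.+1) (N : manifold R n.*2.+1)
  (S : almost_contact_metric M) (T : almost_contact_metric N)
  (f : M -> N) :
  almost_semi_Sasakian S -> smooth_map f -> pm_holomorphic S T f ->
  ((0 < m)%N -> quasi_K_cosymplectic T -> harmonic_map S T f) /\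
  (forall alpha : R, alpha_Sasakian T alpha ->
   forall lambda : M -> R, smooth_function lambda -> tangent_map_xi S T f lambda ->
   (harmonic_map S T f <-> xi_derivative_zero S lambda)).
Proof.
move=> HS fs pm.
have [s [ss hol]] : exists s, s * s = 1 /\ signed_holomorphic S T f s.
  by case: pm => H; [exists 1; rewrite mulr1|exists (-1); rewrite mulrNN mulr1].
split=> [m0 qK|alpha aS l ls Hl]; first exact: quasi_K_harmonic fs _ ss hol HS qK m0.
split=> [Hh i p Hi|Hd i j p Hi Hj].
  (* [xi_derivative_zero] mentions no chart of [N], so one around [f p] is chosen; pairing with its
     [eta] reads off the coefficient of gamma. *)
  have [j Hj] := chart_dom_cover (f p).
  have Hy : chart_image j (chart j (f p)) by exists (f p).
  have := Hh i j p Hi Hj; rewrite (alpha_Sasakian_tension fs ss hol HS Hi Hj aS ls Hl).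
  by move=> /(congr1 (pairing (eta T j (chart j (f p))))); rewrite pairingZ eta_xi// pairing0 mulr1.
by rewrite (alpha_Sasakian_tension fs ss hol HS Hi Hj aS ls Hl) Hd// scale0r.
Qed.
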